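(* Let $M$ be a smooth manifold and let $\nabla$ be a torsion-free induced higher connection on $M$. Then $$\nabla_{X\wedge Y}\omega=(-1)^li_Y\nabla_X\omega+(-1)^{k(l-1)}i_X\nabla_Y\omega$$ for $X\in A^k(M)$, $Y\in A^l(M)$, and $\omega\in\Omega^m(M)$.
   Context: $A^k(M):=\Gamma(\wedge^kTM)$ for $k\ge0$ ($A^0(M)=C^\infty(M)$), $A^k(M):=0$ and $\Omega^k(M):=0$ for $k<0$, $\mathcal{A}(M):=\bigoplus_kA^k(M)$. Schouten–Nijenhuis bracket: the unique $\mathbb{R}$-bilinear map $[\cdot,\cdot]:A^k(M)\times A^l(M)\to A^{k+l-1}(M)$ such that $[f,g]=0$ for functions; $[X,Q]=L_XQ$ for $X\in A^1(M)$; $[P,Q]=-(-1)^{(p-1)(q-1)}[Q,P]$ and $[P,Q\wedge R]=[P,Q]\wedge R+(-1)^{(p-1)q}Q\wedge[P,R]$ for $P\in A^p(M)$, $Q\in A^q(M)$, $R\in\mathcal{A}(M)$. A higher (affine) connection on $M$ is a map $\nabla:\mathcal{A}(M)\times\mathcal{A}(M)\to\mathcal{A}(M)$, $(X,Y)\mapsto\nabla_XY$, such that (i) $\nabla_XY\in A^{k+l-1}(M)$ for $X\in A^k(M)$, $Y\in A^l(M)$; (ii) $\nabla_{fX+X'}Y=f\nabla_XY+\nabla_{X'}Y$ for $f\in C^\infty(M)$; (iii) $\nabla_X(Y+Y')=\nabla_XY+\nabla_XY'$; (iv) $\nabla_Xf=[X,f]$ for $f\in C^\infty(M)$; (v) $\nabla_X(fY)=[X,f]\wedge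 Y+f\nabla_XY$ for $f\in C^\infty(M)$; (vi) $\nabla_fX=0$ for $f\in C^\infty(M)$. It is induced if $\nabla_{X\wedge Y}Z=X\wedge\nabla_YZ+(-1)^{kl}Y\wedge\nabla_XZ$ and $\nabla_X(Y\wedge Z)=(\nabla_XY)\wedge Z+(-1)^{(k-1)l}Y\wedge\nabla_XZ$ for $X\in A^k(M)$, $Y\in A^l(M)$, $Z\in\mathcal{A}(M)$. It is torsion-free if $T(X,Y):=\nabla_XY-(-1)^{(k-1)(l-1)}\nabla_YX-[X,Y]=0$ for all $X\in A^k(M)$, $Y\in A^l(M)$ and all $k,l$. Forms: $\omega\in\Omega^k(M)$ is evaluated on $k$-vectors by $(\omega^1\wedge\cdots\wedge\omega^k)(v_1\wedge\cdots\wedge v_k)=\det(\omega^i(v_j))$; for $\omega\in\Omega^0(M)$ and $f\in A^0(M)$, $\omega(f):=f\omega$. For $X\in A^k(M)$, $k\ge1$, $i_X:\Omega^l(M)\to\Omega^{l-k}(M)$ is $(i_X\omega)(Y)=\omega(X\wedge Y)$ for $l>k$, $i_X\omega=\omega(X)$ for $l=k$, $i_X\omega=0$ for $l<k$; $i_f\omega:=f\omega$ for functions. $L_X\omega:=d\,i_X\omega-(-1)^ki_Xd\omega$ for $X\in A^k(M)$, $k\ge1$. For $\omega\in\Omega^l(M)$, $X\in A^k(M)$, $k>0$, $l-k+1\ge0$, the form $\nabla_X\omega\in\Omega^{l-k+1}(M)$ is defined by $(\nabla_X\omega)(Y):=(-1)^{(k-1)(l-1)}L_Xi_Y\omega-\omega(\nabla_XY)$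 for $Y\in A^{l-k+1}(M)$; for $k=0$ or $l-k+1<0$, $\nabla_X\omega:=0$. *)

(* Defs.v *)
From HB Require Import structures.
From mathcomp Require Import all_boot all_order all_algebra.
From mathcomp Require Import boolp classical_sets functions.
From mathcomp Require Import reals topology normedtype derive.

Set Implicit Arguments.
Unset Strict Implicit.
Unset Printing Implicit Defensive.

Import Order.TTheory GRing.Theory Num.Theory.
Import numFieldNormedType.Exports.

Local Open Scope ring_scope.

(* C^r on an open set O: for r > 0, f is (Frechet) differentiable on O and all
   its directional derivatives are C^(r-1) on O. *)
Fixpoint Cr_on (R : realType) (V W : normedModType R)
    (r : nat) (O : set V) (f : V -> W) : Prop :=
  if r is r'.+1 then
    (forall x, O x -> differentiable f x) /\
    (forall v, Cr_on r' O (fun x => 'D_v f x))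
  else forall x, O x -> {for x, continuous f}.

Definition smooth_on (R : realType) (V W : normedModType R)
    (O : set V) (f : V -> W) : Prop := forall r, Cr_on r O f.

(* The values of cmap outside cdom and of cinv outside cmap @` cdom are
   irrelevant. *)
Record chart (R : realType) (n : nat) (M : topologicalType) := Chart {
  cdom : set M;
  cmap : M -> 'rV[R]_n;
  cinv : 'rV[R]_n -> M;
  cdom_open : open cdom;
  cimg_open : open (cmap @` cdom)%classic;
  cmapK : forall p, cdom p -> cinv (cmap p) = p;
  cmap_continuous : forall p, cdom p -> {for p, continuous cmap};
  cinv_continuous :
    forall x, (cmap @` cdom)%classic x -> {for x, continuous cinv}
}.

Definition cimg (R : realType) (n : nat) (M : topologicalType)
  (c : chart R n M) : set 'rV[R]_n := (cmap c @` cdom c)%classic.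

Record manifold (R : realType) (n : nat) := Manifold {
  mspace :> topologicalType;
  mspace_hausdorff : hausdorff_space mspace;
  mspace_second_countable : @second_countable mspace;
  atlas : set (chart R n mspace);
  atlas_cover : forall p, exists c, atlas c /\ cdom c p;
  atlas_compat : forall c c', atlas c -> atlas c' ->
    smooth_on (cmap c @` (cdom c `&` cdom c'))%classic (cmap c' \o cinv c)
}.

(* An element a of the exterior algebra is given by its components a S on the
   basis e_S = e_{i_1} /\ ... /\ e_{i_r}, S = {i_1 < ... < i_r}. *)
Definition ext (R : realType) (n : nat) := {ffun {set 'I_n} -> R}.
HB.instance Definition _ (R : realType) (n : nat) := GRing.Lmodule.on (ext R n).

Section ExteriorAlgebra.
Context {R : realType} {n : nat}.
Implicit Types (a b : ext R n) (S T : {set 'I_n}).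

Definition ext_basis S : ext R n := [ffun T => (T == S)%:R].

(* (v_0, ..., v_(n-1)) |-> sum_i v_i e_i *)
Definition ext_vec (v : 'rV[R]_n) : ext R n :=
  \sum_(i < n) v 0 i *: ext_basis [set i].

(* The number of transpositions that sort e_S /\ e_T, for disjoint S, T. *)
Definition inversions S T : nat :=
  (\sum_(i in S) \sum_(j in T) (j < i))%N.

Definition ext_mul a b : ext R n :=
  [ffun S => \sum_(T in powerset S)
     (-1) ^+ inversions T (S :\: T) * a T * b (S :\: T)].

(* Here w is a form, with components on the basis dual to (e_S); this is the
   convention (w1 /\ ... /\ wr)(v1 /\ ... /\ vr) = det (wi vj). *)
Definition ext_pair (w a : ext R n) : R := \sum_(S : {set 'I_n}) w S * a S.

(* The form b |-> w (a /\ b). *)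
Definition ext_contract a (w : ext R n) : ext R n :=
  [ffun T => ext_pair w (ext_mul a (ext_basis T))].

(* The algebra endomorphism induced by a linear map J. *)
Definition ext_map (J : 'rV[R]_n -> 'rV[R]_n) a : ext R n :=
  \sum_(S : {set 'I_n})
     a S *: \big[ext_mul/ext_basis finset.set0]_(i in S) ext_vec (J (delta_mx 0 i)).

End ExteriorAlgebra.

Section TensorFields.
Context {R : realType} {n : nat} {M : manifold R n}.
Implicit Types (c : chart R n M) (p : M) (f : M -> R).

(* The tangent space at p is identified with R^n by means of a fixed chart of
   the atlas around p. *)
Definition chart_at p : chart R n M := projT1 (cid (atlas_cover p)).

(* The differential at p of the change of coordinates from c to c'. *)
Definition transition c c' p (v : 'rV[R]_n) : 'rV[R]_n :=
  'D_v (cmap c' \o cinv c) (cmap c p).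

(* An arbitrary section of /\ TM (a multivector field) or of its dual /\ T*M
   (a differential form), not necessarily smooth or homogeneous. The value at
   p consists of the components with respect to chart_at p. *)
Definition field := M -> ext R n.
HB.instance Definition _ := GRing.Lmodule.on field.

(* Components with respect to c of a multivector field, resp. of a form, as
   functions of the coordinates. *)
Definition mv_coord c (P : field) (x : 'rV[R]_n) : ext R n :=
  let p := cinv c x in ext_map (transition (chart_at p) c p) (P p).

Definition form_coord c (w : field) (x : 'rV[R]_n) : ext R n :=
  let p := cinv c x in
  [ffun S => ext_pair (w p)
               (ext_map (transition c (chart_at p) p) (ext_basis S))].

Definition smooth_fun f : Prop :=
  forall c, atlas c -> smooth_on (cimg c) (f \o cinv c).

(* The smooth sections of /\ TM: these form the direct sum of all A^k(M). *)
Definition multivector (P : field) : Prop :=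
  forall c, atlas c ->
  forall S, smooth_on (cimg c) (fun x => mv_coord c P x S).

Definition smooth_form (w : field) : Prop :=
  forall c, atlas c ->
  forall S, smooth_on (cimg c) (fun x => form_coord c w x S).

Definition homogeneous (k : int) (P : field) : Prop :=
  forall p (S : {set 'I_n}), (#|S| : int) <> k -> P p S = 0.

(* A^k(M) and Omega^k(M); they reduce to 0 for k < 0. *)
Definition A (k : int) (P : field) : Prop := multivector P /\ homogeneous k P.

Definition Omega (k : int) (w : field) : Prop :=
  smooth_form w /\ homogeneous k w.

(* A function as an element of A^0(M), and of Omega^0(M). *)
Definition fn f : field := fun p => f p *: ext_basis finset.set0.

Definition fscale f (P : field) : field := fun p => f p *: P p.

Definition wedge (P Q : field) : field := fun p => ext_mul (P p) (Q p).

(* The evaluation w(P) of a k-form on a k-vector field. *)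
Definition pair (w P : field) : M -> R := fun p => ext_pair (w p) (P p).

(* i_P w, for P of degree k >= 0 and w of degree l: this is (i_P w)(Q) =
   w(P /\ Q) for l > k, w(P) for l = k, 0 for l < k, and f w for P = f. *)
Definition iprod (P w : field) : field := fun p => ext_contract (P p) (w p).

(* Derivative of all components in direction e_i of R^n. *)
Definition ext_partial (i : 'I_n) (g : 'rV[R]_n -> ext R n)
    (x : 'rV[R]_n) : ext R n :=
  [ffun S => 'D_(delta_mx 0 i) (fun y => g y S) x].

(* d w = sum_i dx_i /\ (partial_i w), in the coordinates of chart_at p. *)
Definition ext_deriv (w : field) : field := fun p =>
  let c := chart_at p in
  \sum_(i < n) ext_mul (ext_basis [set i])
                       (ext_partial i (form_coord c w) (cmap c p)).

(* L_X Q for a vector field X and a multivector field Q: in the coordinates of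
   chart_at p,
     L_X Q = sum_i X_i partial_i Q - sum_j (partial_j X) /\ (dx_j _| Q),
   i.e. the derivation of the wedge product which is X on functions and
   L_X e_j = - partial_j X on the coordinate vector fields. *)
Definition lie_mv (X Q : field) : field := fun p =>
  let c := chart_at p in
  \sum_(i < n) X p [set i] *: ext_partial i (mv_coord c Q) (cmap c p)
  - \sum_(j < n) ext_mul (ext_partial j (mv_coord c X) (cmap c p))
                         (ext_contract (ext_basis [set j]) (Q p)).

(* L_X w for X in A^k(M), k >= 1. *)
Definition lie_form (k : int) (X w : field) : field :=
  ext_deriv (iprod X w) - (-1) ^ k *: iprod X (ext_deriv w).

(* Operations on multivector fields are represented by functions on arbitrary
   sections; only their values on smooth multivector fields are constrained
   or used. *)

Record is_schouten (br : field -> field -> field) : Prop := IsSchouten {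
  schouten_deg : forall k l P Q, A k P -> A l Q -> A (k + l - 1) (br P Q);
  schouten_linearl : forall (a : R) P P' Q,
    multivector P -> multivector P' -> multivector Q ->
    br (a *: P + P') Q = a *: br P Q + br P' Q;
  schouten_linearr : forall (a : R) P Q Q',
    multivector P -> multivector Q -> multivector Q' ->
    br P (a *: Q + Q') = a *: br P Q + br P Q';
  schouten_fun : forall f g, smooth_fun f -> smooth_fun g ->
    br (fn f) (fn g) = 0;
  schouten_lie : forall l X Q, A 1 X -> A l Q -> br X Q = lie_mv X Q;
  schouten_anti : forall k l P Q, A k P -> A l Q ->
    br P Q = - ((-1) ^ ((k - 1) * (l - 1)) *: br Q P);
  schouten_leibniz : forall k l P Q S, A k P -> A l Q -> multivector S ->
    br P (wedge Q S) =
      wedge (br P Q) S + (-1) ^ ((k - 1) * l) *: wedge Q (br P S)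
}.

Record higher_connection (br nabla : field -> field -> field) : Prop :=
  HigherConnection {
  hc_deg : forall k l X Y, A k X -> A l Y -> A (k + l - 1) (nabla X Y);
  hc_linearl : forall f X X' Y, smooth_fun f ->
    multivector X -> multivector X' -> multivector Y ->
    nabla (fscale f X + X') Y = fscale f (nabla X Y) + nabla X' Y;
  hc_addr : forall X Y Y', multivector X -> multivector Y -> multivector Y' ->
    nabla X (Y + Y') = nabla X Y + nabla X Y';
  hc_fun : forall f X, smooth_fun f -> multivector X ->
    nabla X (fn f) = br X (fn f);
  hc_leibniz : forall f X Y, smooth_fun f -> multivector X -> multivector Y ->
    nabla X (fscale f Y) = wedge (br X (fn f)) Y + fscale f (nabla X Y);
  hc_fun0 : forall f X, smooth_fun f -> multivector X -> nabla (fn f) X = 0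
}.

Record induced (nabla : field -> field -> field) : Prop := Induced {
  induced_l : forall k l X Y Z, A k X -> A l Y -> multivector Z ->
    nabla (wedge X Y) Z =
      wedge X (nabla Y Z) + (-1) ^ (k * l) *: wedge Y (nabla X Z);
  induced_r : forall k l X Y Z, A k X -> A l Y -> multivector Z ->
    nabla X (wedge Y Z) =
      wedge (nabla X Y) Z + (-1) ^ ((k - 1) * l) *: wedge Y (nabla X Z)
}.

Definition torsion (br nabla : field -> field -> field) (k l : int)
    (X Y : field) : field :=
  nabla X Y - (-1) ^ ((k - 1) * (l - 1)) *: nabla Y X - br X Y.

Definition torsion_free (br nabla : field -> field -> field) : Prop :=
  forall k l X Y, A k X -> A l Y -> torsion br nabla k l X Y = 0.

(* eta is the form nabla_X w, for X in A^k(M) and w in Omega^l(M): the element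
   of Omega^(l-k+1)(M) determined by its values on A^(l-k+1)(M). *)
Definition is_nabla_form (nabla : field -> field -> field) (k l : int)
    (X w eta : field) : Prop :=
  if (0 < k) && (0 <= l - k + 1) then
    Omega (l - k + 1) eta /\
    forall Y, A (l - k + 1) Y ->
      fn (pair eta Y) =
        (-1) ^ ((k - 1) * (l - 1)) *: lie_form k X (iprod Y w)
        - fn (pair w (nabla X Y))
  else eta = 0.

End TensorFields.

Arguments field {R n} M.

(* Main.v *)
(** Evaluate both sides on a multivector field [Z].  The terms in [nabla_X Z]
    and [nabla_Y Z] match because nabla is induced; torsion-freeness turns the
    terms in [nabla_X Y] and [nabla_Y X] into [w ([X, Y] /\ Z)].  What remains
    is, for the form [eta = i_Z w] of degree [k + l - 1], the Cartan formula
      [d eta (X /\ Y) = (-1)^((k+1)l) d(i_Y eta)(X) + (-1)^k d(i_X eta)(Y)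
                         + (-1)^k eta([X, Y])].
    With [d_i] the partial derivatives and [iota_i] the contractions by [dx_i]
    in a chart, it follows termwise from
      [[X, Y] = sum_i (-1)^(k+1) iota_i X /\ d_i Y - d_i X /\ iota_i Y]
    by the product rule and graded commutativity.  This formula for the bracket
    holds because both of its sides obey the same Leibniz rule and agree on
    functions and vector fields, which generate: if [phi] is a bump function
    supported in the chart, [phi^(n+1) X] is globally a sum of wedge products of
    the functions and vector fields obtained by cutting off the components of
    [X] and the coordinate fields. *)

Require Import Defs.
From mathcomp Require Import all_boot all_order all_algebra.
From mathcomp Require Import reals.
From mathcomp Require Import zify ring lra.
Set Implicit Arguments.
Unset Strict Implicit.
Unset Printing Implicit Defensive.
Import Order.TTheory GRing.Theory Num.Theory.
Local Open Scope ring_scope.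

(** * The exterior algebra *)

Section Inversions.
Context {n : nat}.
Implicit Types (i j : 'I_n) (S T U : {set 'I_n}).

Lemma inversionsUr S T U : [disjoint T & U] ->
  inversions S (T :|: U) = (inversions S T + inversions S U)%N.
Proof.
move=> dTU; rewrite /inversions -big_split /=; apply: eq_bigr => i _.
by rewrite (eq_bigl [predU T & U]) ?bigU // => j; rewrite !inE.
Qed.

Lemma inversionsUl S T U : [disjoint S & T] ->
  inversions (S :|: T) U = (inversions S U + inversions T U)%N.
Proof.
move=> dST; rewrite /inversions (eq_bigl [predU S & T]) ?bigU // => j.
by rewrite !inE.
Qed.

Lemma inversions0l S : inversions set0 S = 0%N.
Proof. by rewrite /inversions big_set0. Qed.

Lemma inversions0r S : inversions S set0 = 0%N.
Proof. by rewrite /inversions big1 // => i _; rewrite big_set0. Qed.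

Lemma inversions1 i j : inversions [set i] [set j] = (j < i)%N.
Proof. by rewrite /inversions !big_set1. Qed.

Lemma inversions_lt i S : (forall j, j \in S -> (i < j)%N) -> inversions [set i] S = 0%N.
Proof.
move=> H; rewrite /inversions big_set1 big1 // => j /H ij.
by rewrite ltnNge (ltnW ij).
Qed.

(** Disjointness rules out [i = j], so each pair of indices from [S] and [T] is an inversion in
    exactly one of the two orders. This is the source of the sign in [ext_mulC]. *)
Lemma inversions_swap S T : [disjoint S & T] ->
  (inversions S T + inversions T S)%N = (#|S| * #|T|)%N.
Proof.
move=> dST; rewrite /inversions [X in (_ + X)%N]exchange_big /= -big_split /=.
rewrite -sum1_card big_distrl /=; apply: eq_bigr => i iS.
rewrite -big_split /= mul1n -sum1_card; apply: eq_bigr => j jT.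
have : i != j by apply: contraTneq jT => <-; rewrite (disjointFr dST).
by rewrite -val_eqE /=; case: ltngtP.
Qed.

Lemma disjointUl S T U : [disjoint S :|: T & U] = [disjoint S & U] && [disjoint T & U].
Proof. by rewrite !disjoints_subset subUset. Qed.

Lemma disjointUr S T U : [disjoint U & S :|: T] = [disjoint U & S] && [disjoint U & T].
Proof. by rewrite ![[disjoint U & _]]disjoint_sym disjointUl. Qed.

(** Splitting off the least element keeps inductions free of signs: the product of [e_j] and [e_S]
    is exactly [e_(j |: S)] when [j] lies below [S]. *)
Lemma set_min_ind (P : {set 'I_n} -> Prop) : P set0 ->
  (forall j S, (forall i, i \in S -> (j < i)%N) -> P S -> P (j |: S)) -> forall S, P S.
Proof.
move=> P0 PU S; elim: {S}#|S| {-2}S (erefl #|S|) => [|m IH] S cS.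
  by rewrite (cards0_eq cS).
have /card_gt0P[i0 i0S] : (0 < #|S|)%N by rewrite cS.
case: (arg_minnP (fun i : 'I_n => val i) i0S) => j.
rewrite -[_ j]/(j \in S) => jS jmin; rewrite -(setD1K jS); apply: PU.
  move=> i; rewrite !inE => /andP[ij iS].
  by rewrite ltn_neqAle jmin // andbT; apply: contra ij => /eqP /val_inj ->.
by apply: IH; apply: succn_inj; rewrite -cS (cardsD1 j S) jS.
Qed.

End Inversions.

(** * Exterior product, pairing and contraction *)

Section ExteriorAlgebraTheory.
Context {R : realType} {n : nat}.
Implicit Types (a b c w : ext R n) (S T U : {set 'I_n}) (i j : 'I_n) (k l : int).

Local Notation e := (@ext_basis R n).

Lemma ext_mulE a b S : ext_mul a b S = \sum_(T in powerset S)
     (-1) ^+ inversions T (S :\: T) * a T * b (S :\: T).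
Proof. by rewrite ffunE. Qed.

Lemma ext_mulDl a b c : ext_mul (a + b) c = ext_mul a c + ext_mul b c.
Proof.
apply/ffunP => S; rewrite !ffunE -big_split; apply: eq_bigr => T _ /=.
by rewrite !ffunE mulrDr mulrDl.
Qed.

Lemma ext_mulDr a b c : ext_mul a (b + c) = ext_mul a b + ext_mul a c.
Proof.
apply/ffunP => S; rewrite !ffunE -big_split; apply: eq_bigr => T _ /=.
by rewrite !ffunE mulrDr.
Qed.

Lemma ext_mulZl (x : R) a b : ext_mul (x *: a) b = x *: ext_mul a b.
Proof.
apply/ffunP => S; rewrite !ffunE scaler_sumr; apply: eq_bigr => T _ /=.
by rewrite !ffunE /GRing.scale /=; ring.
Qed.

Lemma ext_mulZr (x : R) a b : ext_mul a (x *: b) = x *: ext_mul a b.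
Proof.
apply/ffunP => S; rewrite !ffunE scaler_sumr; apply: eq_bigr => T _ /=.
by rewrite !ffunE /GRing.scale /=; ring.
Qed.

Lemma ext_mul0l a : ext_mul 0 a = 0.
Proof. by rewrite -(scale0r (0 : ext R n)) ext_mulZl !scale0r. Qed.

Lemma ext_mul0r a : ext_mul a 0 = 0.
Proof. by rewrite -(scale0r (0 : ext R n)) ext_mulZr !scale0r. Qed.

Lemma ext_mulNl a b : ext_mul (- a) b = - ext_mul a b.
Proof. by rewrite -scaleN1r ext_mulZl scaleN1r. Qed.

Lemma ext_mulNr a b : ext_mul a (- b) = - ext_mul a b.
Proof. by rewrite -scaleN1r ext_mulZr scaleN1r. Qed.

Lemma ext_mul_suml (I : Type) (s : seq I) (P : pred I) (F : I -> ext R n) b :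
  ext_mul (\sum_(i <- s | P i) F i) b = \sum_(i <- s | P i) ext_mul (F i) b.
Proof. by apply: (big_morph (ext_mul^~ b)) => [x y|]; rewrite ?ext_mul0l ?ext_mulDl. Qed.

Lemma ext_mul_sumr (I : Type) (s : seq I) (P : pred I) (F : I -> ext R n) b :
  ext_mul b (\sum_(i <- s | P i) F i) = \sum_(i <- s | P i) ext_mul b (F i).
Proof. by apply: (big_morph (ext_mul b)) => [x y|]; rewrite ?ext_mul0r ?ext_mulDr. Qed.

Lemma ext_basisE S T : e S T = (T == S)%:R.
Proof. by rewrite ffunE. Qed.

Lemma ext_decomp a : a = \sum_S a S *: e S.
Proof.
apply/ffunP => T; rewrite sum_ffunE (bigD1 T) //= !ffunE eqxx [_ *: _]mulr1.
by rewrite big1 ?addr0 // => S ST; rewrite !ffunE eq_sym (negPf ST) scaler0.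
Qed.

Definition ext_hom k a := forall S, (#|S| : int) <> k -> a S = 0.

Lemma ext_hom_basis S : ext_hom #|S| (e S).
Proof. by move=> T cT; rewrite ext_basisE; case: eqP => // ET; case: cT; rewrite ET. Qed.

Arguments ext_hom_basis : clear implicits.

Lemma ext_hom0 k : ext_hom k 0.
Proof. by move=> S _; rewrite ffunE. Qed.

Lemma ext_homD k a b : ext_hom k a -> ext_hom k b -> ext_hom k (a + b).
Proof. by move=> ha hb S cS; rewrite ffunE ha ?hb ?addr0. Qed.

Lemma ext_homZ k (x : R) a : ext_hom k a -> ext_hom k (x *: a).
Proof. by move=> ha S cS; rewrite ffunE ha // scaler0. Qed.

Lemma ext_hom_sum k (I : Type) (s : seq I) (P : pred I) (F : I -> ext R n) :
  (forall x, P x -> ext_hom k (F x)) -> ext_hom k (\sum_(i <- s | P i) F i).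
Proof. by move=> hF; apply: big_ind => //; [exact: ext_hom0|exact: ext_homD]. Qed.

Lemma ext_hom_lt0 k a : ext_hom k a -> k < 0 -> a = 0.
Proof. by move=> ha k0; apply/ffunP => S; rewrite ffunE ha // => cS; lia. Qed.

Lemma ext_ind (P : ext R n -> Prop) : P 0 -> (forall a b, P a -> P b -> P (a + b)) ->
  (forall x a, P a -> P (x *: a)) -> (forall S, P (e S)) -> forall a, P a.
Proof.
move=> P0 PD PZ Pe a; rewrite (ext_decomp a); apply: big_ind => // S _.
exact: PZ (Pe S).
Qed.

Lemma ext_hom_ind k (P : ext R n -> Prop) : P 0 -> (forall a b, P a -> P b -> P (a + b)) ->
  (forall x a, P a -> P (x *: a)) -> (forall S, #|S| = k :> int -> P (e S)) ->
  forall a, ext_hom k a -> P a.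
Proof.
move=> P0 PD PZ Pe a ha; rewrite (ext_decomp a); apply: big_ind => // S _.
have [cS|/eqP cS] := eqVneq (#|S| : int) k; first exact: PZ (Pe S cS).
by rewrite ha // scale0r.
Qed.

Lemma ext_mul_basis S T : ext_mul (e S) (e T) =
  if [disjoint S & T] then (-1) ^+ inversions S T *: e (S :|: T) else 0.
Proof.
apply/ffunP => W; rewrite ext_mulE.
(* Only the summand indexed by [S] survives in the component at [W]. The right-hand side is brought
   to that shape; its test fails automatically when [S] and [T] meet. *)
have -> : (if [disjoint S & T] then (-1) ^+ inversions S T *: e (S :|: T) else 0) W =
   (-1) ^+ inversions S T * ((S \subset W) && (W :\: S == T))%:R.
  case: ifPn => [dST|ndST]; rewrite !ffunE.
    congr (_ * _%:R); congr nat_of_bool; apply/eqP/andP => [->|[sSW /eqP <-]].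
      split; first exact: subsetUl.
      by apply/eqP; rewrite setDUl setDv set0U; apply/setDidPl; rewrite disjoint_sym.
    by apply/setP => x; rewrite !inE; case: (boolP (x \in S)) => // /(subsetP sSW) ->.
  case: andP => [[sSW /eqP ET]|_]; last by rewrite mulr0.
  by move: ndST; rewrite -ET disjoint_sym disjoints_subset subsetDr.
have [sSW|nsSW] := boolP (S \subset W); last first.
  rewrite mulr0 big1 // => V; rewrite powersetE !ffunE => sVW.
  by rewrite (_ : V == S = false) ?mulr0 ?mul0r //; apply: contraNF nsSW => /eqP <-.
rewrite (bigD1 S) ?powersetE //= !ffunE eqxx mulr1 big1 ?addr0.
  by case: eqP => [->|_]; rewrite ?mulr1 ?mulr0.
by move=> V /andP[_ VS]; rewrite !ffunE (negPf VS) mulr0 mul0r.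
Qed.

Lemma ext_mul1l a : ext_mul (e set0) a = a.
Proof.
elim/ext_ind: a => [|a b {2}<- {2}<-|x a {2}<-|S].
- exact: ext_mul0r.
- exact: ext_mulDr.
- exact: ext_mulZr.
- by rewrite ext_mul_basis disjoints_subset sub0set inversions0l scale1r set0U.
Qed.

Lemma ext_mul1r a : ext_mul a (e set0) = a.
Proof.
elim/ext_ind: a => [|a b {2}<- {2}<-|x a {2}<-|S].
- exact: ext_mul0l.
- exact: ext_mulDl.
- exact: ext_mulZl.
- by rewrite ext_mul_basis disjoint_sym disjoints_subset sub0set inversions0r scale1r setU0.
Qed.

Lemma ext_mulA a b c : ext_mul a (ext_mul b c) = ext_mul (ext_mul a b) c.
Proof.
have lin := (ext_mul0l, ext_mul0r, ext_mulDl, ext_mulZl, ext_mulDr, ext_mulZr).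
elim/ext_ind: a => [|a1 a2 h1 h2|x a h|S]; rewrite ?lin ?h1 ?h2 ?h //.
elim/ext_ind: b => [|a1 a2 h1 h2|x a h|T]; rewrite ?lin ?h1 ?h2 ?h //.
elim/ext_ind: c => [|a1 a2 h1 h2|x a h|U]; rewrite ?lin ?h1 ?h2 ?h //.
rewrite !ext_mul_basis.
(* Since [inversions] is additive in both arguments, both bracketings equal this expression, in
   which the three factors are paired without any grouping. *)
transitivity (if [&& [disjoint S & T], [disjoint S & U] & [disjoint T & U]]
  then (-1) ^+ (inversions S T + inversions S U + inversions T U) *: e (S :|: T :|: U)
  else 0 : ext R n).
  case: (boolP [disjoint T & U]) => dTU; last by rewrite ext_mul0r !andbF.
  rewrite ext_mulZr ext_mul_basis disjointUr andbT; case: ifP; last by rewrite scaler0.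
  by move=> _; rewrite inversionsUr // scalerA -exprD addnC setUA.
case: (boolP [disjoint S & T]) => dST; last by rewrite ext_mul0l.
rewrite ext_mulZl ext_mul_basis disjointUl /=; case: ifP; last by rewrite scaler0.
by move=> _; rewrite inversionsUl // scalerA -exprD addnA.
Qed.

Lemma signz_intE k : (-1 : R) ^ k = (-1) ^+ `|k|%N.
Proof. by case: k => m //; rewrite -[LHS]/((-1) ^- m.+1) -exprVn invrN1. Qed.

(** Signs with integer exponents depend only on parities, so every sign identity below becomes a
    finite check over the parities of the degrees. *)
Lemma signz_odd k : (-1 : R) ^ k = if odd `|k|%N then -1 else 1.
Proof. by rewrite signz_intE -signr_odd; case: odd. Qed.

Lemma ext_hom_mul k l a b : ext_hom k a -> ext_hom l b -> ext_hom (k + l) (ext_mul a b).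
Proof.
move=> ha hb S cS; rewrite ext_mulE big1 // => T; rewrite powersetE => sTS.
have [cT|/eqP cT] := eqVneq (#|T| : int) k; last by rewrite ha // mulr0 mul0r.
rewrite hb ?mulr0 // => cST; apply: cS.
by rewrite -(cardsID T S) (setIidPr sTS) PoszD cT cST.
Qed.

(** By bilinearity it suffices to compare basis elements, where the two sorting signs differ by the
    count in [inversions_swap]. *)
Lemma ext_mulC k l a b : ext_hom k a -> ext_hom l b ->
  ext_mul a b = (-1) ^ (k * l) *: ext_mul b a.
Proof.
move=> ha hb; elim/ext_hom_ind: ha => [|a1 a2 h1 h2|x a1 h|S cS].
- by rewrite ext_mul0l ext_mul0r scaler0.
- by rewrite ext_mulDl ext_mulDr h1 h2 scalerDr.
- by rewrite ext_mulZl ext_mulZr h scalerA mulrC -scalerA.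
elim/ext_hom_ind: hb => [|a1 a2 h1 h2|x a1 h|T cT].
- by rewrite ext_mul0l ext_mul0r scaler0.
- by rewrite ext_mulDl ext_mulDr h1 h2 scalerDr.
- by rewrite ext_mulZl ext_mulZr h scalerA mulrC -scalerA.
rewrite !ext_mul_basis disjoint_sym setUC; case: ifP => [dTS|_]; last by rewrite scaler0.
rewrite scalerA; congr (_ *: _); rewrite -cS -cT -PoszM -exprnP.
by rewrite -inversions_swap 1?disjoint_sym // exprD -mulrA -expr2 sqrr_sign mulr1.
Qed.

Lemma ext_pairC a b : ext_pair a b = ext_pair b a.
Proof. by apply: eq_bigr => S _; rewrite mulrC. Qed.

Lemma ext_pairDr w a b : ext_pair w (a + b) = ext_pair w a + ext_pair w b.
Proof. by rewrite /ext_pair -big_split; apply: eq_bigr => S _; rewrite ffunE mulrDr. Qed.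

Lemma ext_pairZr (x : R) w a : ext_pair w (x *: a) = x * ext_pair w a.
Proof. by rewrite /ext_pair mulr_sumr; apply: eq_bigr => S _; rewrite ffunE mulrCA. Qed.

Lemma ext_pair0r w : ext_pair w 0 = 0.
Proof. by rewrite /ext_pair big1 // => S _; rewrite ffunE mulr0. Qed.

Lemma ext_pairNr w a : ext_pair w (- a) = - ext_pair w a.
Proof. by rewrite -scaleN1r ext_pairZr mulN1r. Qed.

Lemma ext_pair_sumr (I : Type) (s : seq I) (P : pred I) (F : I -> ext R n) w :
  ext_pair w (\sum_(i <- s | P i) F i) = \sum_(i <- s | P i) ext_pair w (F i).
Proof. by apply: (big_morph (ext_pair w)) => [x y|]; rewrite ?ext_pair0r ?ext_pairDr. Qed.

Lemma ext_pairDl w a b : ext_pair (a + b) w = ext_pair a w + ext_pair b w.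
Proof. by rewrite !(ext_pairC _ w) ext_pairDr. Qed.

Lemma ext_pairZl (x : R) w a : ext_pair (x *: a) w = x * ext_pair a w.
Proof. by rewrite !(ext_pairC _ w) ext_pairZr. Qed.

Lemma ext_pair_suml (I : Type) (s : seq I) (P : pred I) (F : I -> ext R n) w :
  ext_pair (\sum_(i <- s | P i) F i) w = \sum_(i <- s | P i) ext_pair (F i) w.
Proof. by rewrite ext_pairC ext_pair_sumr; apply: eq_bigr => i _; rewrite ext_pairC. Qed.

Lemma ext_pair_basis w S : ext_pair w (e S) = w S.
Proof.
rewrite /ext_pair (bigD1 S) //= ext_basisE eqxx mulr1 big1 ?addr0 // => T TS.
by rewrite ext_basisE (negPf TS) mulr0.
Qed.

Lemma ext_pair_contract a w b : ext_pair (ext_contract a w) b = ext_pair w (ext_mul a b).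
Proof.
elim/ext_ind: b => [|b c hb hc|x b hb|S].
- by rewrite ext_mul0r !ext_pair0r.
- by rewrite ext_mulDr !ext_pairDr hb hc.
- by rewrite ext_mulZr !ext_pairZr hb.
- by rewrite ext_pair_basis ffunE.
Qed.

Lemma ext_pair_inj a b : (forall S, ext_pair a (e S) = ext_pair b (e S)) -> a = b.
Proof. by move=> H; apply/ffunP => S; rewrite -!ext_pair_basis. Qed.

Lemma ext_contractDr a w v : ext_contract a (w + v) = ext_contract a w + ext_contract a v.
Proof. by apply/ffunP => S; rewrite !ffunE ext_pairDl. Qed.

Lemma ext_contractZr (x : R) a w : ext_contract a (x *: w) = x *: ext_contract a w.
Proof. by apply/ffunP => S; rewrite !ffunE ext_pairZl. Qed.

Lemma ext_contract0l w : ext_contract 0 w = 0.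
Proof. by apply/ffunP => S; rewrite !ffunE ext_mul0l ext_pair0r. Qed.

Lemma ext_contract0r a : ext_contract a 0 = 0.
Proof. by rewrite -(scale0r (0 : ext R n)) ext_contractZr !scale0r. Qed.

Lemma ext_hom_pair k l a b : ext_hom k a -> ext_hom l b -> k <> l -> ext_pair a b = 0.
Proof.
move=> ha hb kl; rewrite /ext_pair big1 // => S _.
have [cS|/eqP cS] := eqVneq (#|S| : int) k; last by rewrite ha // mul0r.
by rewrite hb ?mulr0 // cS.
Qed.

Lemma ext_hom_contract k l a w : ext_hom k a -> ext_hom l w -> ext_hom (l - k) (ext_contract a w).
Proof.
move=> ha hw S cS; rewrite ffunE.
by apply: (ext_hom_pair hw (ext_hom_mul ha (ext_hom_basis S))); lia.
Qed.

Lemma ext_hom_basis1 i : ext_hom 1 (e [set i]).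
Proof. by have := ext_hom_basis [set i]; rewrite cards1. Qed.

(** Contraction of a multivector by the covector [dx_i]. Multivectors and forms share the type
    [ext], so [ext_contract] serves with [e_i] read as [dx_i]; [ext_pair_iota] makes it the
    transpose of left multiplication by [dx_i]. *)
Definition ext_iota i a : ext R n := ext_contract (e [set i]) a.

Lemma ext_iota_hom k i a : ext_hom k a -> ext_hom (k - 1) (ext_iota i a).
Proof. by apply: ext_hom_contract; exact: ext_hom_basis1. Qed.

Lemma ext_pair_iota i w a : ext_pair (ext_mul (e [set i]) w) a = ext_pair w (ext_iota i a).
Proof. by rewrite ext_pairC -ext_pair_contract ext_pairC. Qed.

Lemma ext_iota_basis i S : ext_iota i (e S) =
  if i \in S then (-1) ^+ inversions [set i] (S :\ i) *: e (S :\ i) else 0.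
Proof.
apply/ffunP => T; rewrite ffunE ext_pairC ext_pair_basis ext_mul_basis.
rewrite disjoints_subset sub1set inE.
case: (boolP (i \in T)) => iT /=.
  case: ifP => iS; rewrite !ffunE // (_ : T == _ = false) ?scaler0 //.
  by apply: contraTF iT => /eqP ->; rewrite !inE eqxx.
rewrite !ffunE; case: ifPn => iS; rewrite ?ffunE.
  case: eqP => [->|ne]; first by rewrite setU1K // eqxx.
  by case: eqP => [TE|]; rewrite ?scaler0 //; case: ne; rewrite TE setD1K.
by case: eqP => [SE|]; rewrite ?scaler0 //; move: iS; rewrite SE !inE eqxx.
Qed.

(** This is the canonical anticommutation relation between multiplication by [e_j] and contraction
    by [dx_i]. On basis elements it is a case analysis on [i = j] and on membership of [i] and [j]
    in [S]. *)
Lemma ext_iota_mul_vec i j a : ext_iota i (ext_mul (e [set j]) a) =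
  (i == j)%:R *: a - ext_mul (e [set j]) (ext_iota i a).
Proof.
elim/ext_ind: a => [|b c hb hc|x b hb|S].
- by rewrite /ext_iota !(ext_mul0r, ext_contract0r) scaler0 subr0.
- rewrite /ext_iota !(ext_mulDr, ext_contractDr) -/(ext_iota i _) -/(ext_iota i b) -/(ext_iota i c).
  by rewrite -/(ext_iota i (ext_mul _ c)) hb hc scalerDr opprD addrACA.
- rewrite /ext_iota !(ext_mulZr, ext_contractZr) -/(ext_iota i _) hb -/(ext_iota i _) scalerBr.
  by rewrite !scalerA mulrC.
rewrite ext_iota_basis ext_mul_basis disjoints_subset sub1set inE.
have [<-{j}|ij] := eqVneq i j; rewrite ?scale1r ?scale0r.
  case: (boolP (i \in S)) => iS /=.
    rewrite /ext_iota ext_contract0r ext_mulZr ext_mul_basis.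
    rewrite disjoints_subset sub1set !inE eqxx /= scalerA -expr2 sqrr_sign scale1r.
    by rewrite setD1K // subrr.
  rewrite /ext_iota ext_contractZr -/(ext_iota i _) ext_iota_basis !inE eqxx /= setU1K // scalerA.
  by rewrite -expr2 sqrr_sign scale1r ext_mul0r subr0.
rewrite sub0r; case: (boolP (j \in S)) => jS /=.
  rewrite /ext_iota ext_contract0r; case: ifP => _; last by rewrite ext_mul0r oppr0.
  rewrite ext_mulZr ext_mul_basis disjoints_subset sub1set !inE eq_sym jS (negPf ij) /=.
  by rewrite scaler0 oppr0.
rewrite /ext_iota ext_contractZr -/(ext_iota i _) ext_iota_basis !inE (negPf ij) /=.
case: (boolP (i \in S)) => iS; last by rewrite scaler0 ext_mul0r oppr0.
rewrite ext_mulZr ext_mul_basis disjoints_subset sub1set !inE negb_and jS orbT.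
have E : (j |: S) :\ i = j |: S :\ i.
  by apply/setP => x; rewrite !inE; case: (eqVneq x i) => // ->; rewrite (negPf ij).
rewrite E !scalerA -scaleNr; congr (_ *: _); rewrite -{1}(setD1K iS).
rewrite !inversionsUr ?inversions1; first last.
- by rewrite disjoints_subset sub1set !inE eqxx.
- by rewrite disjoints_subset sub1set !inE (negPf jS) andbF.
(* Exactly one of [i < j] and [j < i] holds: this single transposition produces the minus sign. *)
rewrite !exprD; have : ((-1 : R) ^+ (i < j)%N) = - (-1) ^+ (j < i)%N.
  by move: ij; rewrite -val_eqE /=; case: ltngtP => //; rewrite ?expr1 ?expr0 ?opprK.
by move=> ->; case: (j < i)%N; rewrite ?expr1 ?expr0; ring.
Qed.

Lemma ext_basis_min j S : (forall i, i \in S -> (j < i)%N) ->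
  j \notin S /\ e (j |: S) = ext_mul (e [set j]) (e S).
Proof.
move=> jS; have nj : j \notin S by apply/negP => /jS; rewrite ltnn.
by rewrite ext_mul_basis disjoints_subset sub1set inE nj inversions_lt // scale1r.
Qed.

(** The first factor is built up one basis vector at a time from the left, and each vector that the
    contraction passes contributes a sign by [ext_iota_mul_vec]. *)
Lemma ext_iota_mul k i a b : ext_hom k a ->
  ext_iota i (ext_mul a b) = ext_mul (ext_iota i a) b + (-1) ^ k *: ext_mul a (ext_iota i b).
Proof.
move=> ha; elim/ext_hom_ind: ha => [|a1 a2 h1 h2|x a1 h|S].
- by rewrite /ext_iota !(ext_mul0l, ext_contract0r) scaler0 addr0.
- rewrite ext_mulDl /ext_iota !ext_contractDr -/(ext_iota i _) h1 -/(ext_iota i (ext_mul a2 b)) h2.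
  by rewrite -/(ext_iota i a2) -/(ext_iota i a1) -/(ext_iota i b) !ext_mulDl scalerDr addrACA.
- rewrite ext_mulZl /ext_iota !ext_contractZr -/(ext_iota i _) h -/(ext_iota i a1) -/(ext_iota i b).
  by rewrite !ext_mulZl scalerDr; congr (_ + _); rewrite !scalerA mulrC.
move=> <- {k}; elim/(@set_min_ind n): S b => [|j S jS IH] b.
  by rewrite ext_iota_basis inE ext_mul0l add0r !ext_mul1l cards0 scale1r.
have [nj ->] := ext_basis_min jS; rewrite -ext_mulA !ext_iota_mul_vec IH cardsU1 nj.
rewrite -!exprnP add1n exprS mulN1r ext_mulDr opprD addrA ext_mulDl ext_mulNl.
by rewrite ext_mulZl ext_mulA ext_mulZr -scaleNr -!ext_mulA.
Qed.

(** * Algebra endomorphisms induced by linear maps *)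

Section ExtMap.
Variable J : 'rV[R]_n -> 'rV[R]_n.
Local Notation v i := (ext_vec (J (delta_mx 0 i))).
Local Notation V S := (\big[ext_mul/e set0]_(i in S) v i).

Lemma ext_vecE (u : 'rV[R]_n) S :
  ext_vec u S = \sum_(i < n) u 0 i * (S == [set i])%:R.
Proof. by rewrite sum_ffunE; apply: eq_bigr => i _; rewrite !ffunE. Qed.

Lemma ext_vec_hom (u : 'rV[R]_n) : ext_hom 1 (ext_vec u).
Proof. by apply: ext_hom_sum => i _; apply: ext_homZ; exact: ext_hom_basis1. Qed.

Arguments ext_vec_hom : clear implicits.

(** Graded commutativity in degree 1 equates the square with its own negative, and 2 is
    invertible. *)
Lemma ext_vec_sq (u : 'rV[R]_n) : ext_mul (ext_vec u) (ext_vec u) = 0.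
Proof.
have := ext_mulC (ext_vec_hom u) (ext_vec_hom u); rewrite mulr1 expr1z scaleN1r.
move/eqP; rewrite -addr_eq0 -mulr2n -scaler_nat scaler_eq0 pnatr_eq0 /=.
by move/eqP.
Qed.

Lemma ext_vec_anti (u u' : 'rV[R]_n) :
  ext_mul (ext_vec u) (ext_vec u') = - ext_mul (ext_vec u') (ext_vec u).
Proof. by rewrite (ext_mulC (ext_vec_hom u) (ext_vec_hom u')) mulr1 expr1z scaleN1r. Qed.

Lemma ext_mapD a b : ext_map J (a + b) = ext_map J a + ext_map J b.
Proof.
rewrite /ext_map -big_split; apply: eq_bigr => S _ /=.
by rewrite ffunE scalerDl.
Qed.

Lemma ext_mapZ (x : R) a : ext_map J (x *: a) = x *: ext_map J a.
Proof.
rewrite /ext_map scaler_sumr; apply: eq_bigr => S _ /=.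
by rewrite ffunE scalerA.
Qed.

Lemma ext_map0 : ext_map J 0 = 0.
Proof. by rewrite -(scale0r (0 : ext R n)) ext_mapZ !scale0r. Qed.

Lemma ext_mapN a : ext_map J (- a) = - ext_map J a.
Proof. by rewrite -scaleN1r ext_mapZ scaleN1r. Qed.

Lemma ext_map_sum (I : Type) (s : seq I) (P : pred I) (F : I -> ext R n) :
  ext_map J (\sum_(i <- s | P i) F i) = \sum_(i <- s | P i) ext_map J (F i).
Proof. by apply: (big_morph (ext_map J)) => [x y|]; rewrite ?ext_map0 ?ext_mapD. Qed.

Lemma ext_map_basis S : ext_map J (e S) = V S.
Proof.
rewrite /ext_map (bigD1 S) //= ext_basisE eqxx scale1r big1 ?addr0 // => T TS.
by rewrite ext_basisE (negPf TS) scale0r.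
Qed.

Lemma ext_map1 : ext_map J (e set0) = e set0.
Proof. by rewrite ext_map_basis big_set0. Qed.

(** The product is not commutative, so the order of its factors matters: the enumeration of ['I_n]
    is increasing and therefore puts the least index first. *)
Lemma ext_prod_min j S : (forall i, i \in S -> (j < i)%N) -> V (j |: S) = ext_mul (v j) (V S).
Proof.
move=> jS; have nj : j \notin S by apply/negP => /jS; rewrite ltnn.
rewrite -![\big[_/_]_(i in _) _]big_filter.
suff -> : [seq i <- index_enum 'I_n | i \in j |: S] =
    j :: [seq i <- index_enum 'I_n | i \in S] by rewrite big_cons.
have lt_tr : transitive (fun i i' : 'I_n => (i < i')%N) by move=> ? ? ?; exact: ltn_trans.
have srt : sorted (fun i i' : 'I_n => (i < i')%N) (index_enum 'I_n).
  by rewrite -[index_enum _]enumT; have := iota_ltn_sorted 0 n; rewrite -val_enum_ord sorted_map.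
apply: (@irr_sorted_eq _ (fun i i' : 'I_n => (i < i')%N)) => //.
- by move=> i; rewrite /= ltnn.
- exact: sorted_filter.
- rewrite /= path_min_sorted; last by apply/allP => i; rewrite mem_filter => /andP[/jS].
  exact: sorted_filter.
- by move=> i; rewrite !(inE, mem_filter) mem_index_enum !andbT.
Qed.

Lemma ext_map_basis_min j S : (forall i, i \in S -> (j < i)%N) ->
  ext_map J (e (j |: S)) = ext_mul (v j) (ext_map J (e S)).
Proof. by move=> jS; rewrite !ext_map_basis ext_prod_min. Qed.

(** Induction on the basis set, comparing [j] with its least element [t]. If [j < t], the product is
    already sorted; if [t < j], [e_j] moves past [e_t] and the image vectors anticommute in the same
    way; if [j = t], both sides vanish by [ext_vec_sq]. *)
Lemma ext_map_mul_vec j b :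
  ext_map J (ext_mul (e [set j]) b) = ext_mul (v j) (ext_map J b).
Proof.
elim/ext_ind: b => [|b c hb hc|x b hb|S].
- by rewrite ext_mul0r ext_map0 ext_mul0r.
- by rewrite ext_mulDr !ext_mapD ext_mulDr hb hc.
- by rewrite ext_mulZr !ext_mapZ ext_mulZr hb.
elim/(@set_min_ind n): S => [|t S tS IH].
  by rewrite ext_mul1r -ext_map_basis_min ?setU0 // => i; rewrite inE.
have [ntS eS] := ext_basis_min tS; rewrite ext_map_basis_min //.
have [jt|tj|/val_inj ->] := ltngtP j t.
- have jtS i : i \in t |: S -> (j < i)%N.
    by rewrite !inE => /predU1P[->//|/tS]; exact: ltn_trans.
  by have [_ <-] := ext_basis_min jtS; rewrite ext_map_basis_min // ext_map_basis_min.
- rewrite eS ext_mulA (ext_mulC (ext_hom_basis1 j) (ext_hom_basis1 t)).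
  rewrite mulr1 expr1z scaleN1r ext_mulNl ext_mapN -ext_mulA.
  rewrite [RHS]ext_mulA ext_vec_anti ext_mulNl -[in RHS]ext_mulA -IH; congr (- _).
  rewrite ext_mul_basis; case: ifP => _; last by rewrite !(ext_mul0r, ext_map0).
  rewrite ext_mulZr !ext_mapZ ext_mulZr; congr (_ *: _).
  have tjS i : i \in j |: S -> (t < i)%N by rewrite !inE => /predU1P[->//|/tS].
  by have [_ <-] := ext_basis_min tjS; exact: ext_map_basis_min.
- rewrite eS !ext_mulA ext_vec_sq ext_mul0l ext_mul_basis disjoints_subset.
  by rewrite sub1set !inE eqxx ext_mul0l ext_map0.
Qed.

Lemma ext_map_mul a b : ext_map J (ext_mul a b) = ext_mul (ext_map J a) (ext_map J b).
Proof.
elim/ext_ind: a => [|a c ha hc|x a ha|S].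
- by rewrite !(ext_mul0l, ext_map0).
- by rewrite ext_mulDl !ext_mapD ext_mulDl ha hc.
- by rewrite ext_mulZl !ext_mapZ ext_mulZl ha.
elim/(@set_min_ind n): S => [|j S jS IH]; first by rewrite ext_map1 !ext_mul1l.
rewrite ext_map_basis_min // -ext_mulA -IH -ext_map_mul_vec.
by have [_ ->] := ext_basis_min jS; rewrite ext_mulA.
Qed.

Lemma ext_map_hom k a : ext_hom k a -> ext_hom k (ext_map J a).
Proof.
move=> ha; elim/ext_hom_ind: ha => [|a1 a2 h1 h2|x a1 h|S <-].
- by rewrite ext_map0; exact: ext_hom0.
- by rewrite ext_mapD; exact: ext_homD.
- by rewrite ext_mapZ; exact: ext_homZ.
elim/(@set_min_ind n): S => [|j S jS IH]; first by rewrite ext_map1; exact: ext_hom_basis.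
rewrite ext_map_basis_min // cardsU1 (ext_basis_min jS).1 PoszD.
exact: ext_hom_mul (ext_vec_hom _) IH.
Qed.

Lemma ext_map_vec (u : 'rV[R]_n) :
  J u = \sum_(i < n) u 0 i *: J (delta_mx 0 i) -> ext_map J (ext_vec u) = ext_vec (J u).
Proof.
move=> ->; rewrite ext_map_sum /ext_vec; under [RHS]eq_bigr do rewrite summxE scaler_suml.
rewrite [RHS]exchange_big /=; apply: eq_bigr => i _; rewrite ext_mapZ.
have := @ext_map_basis_min i set0; rewrite setU0 => -> => [|j]; last by rewrite inE.
rewrite ext_map1 ext_mul1r scaler_sumr; apply: eq_bigr => j _.
by rewrite mxE scalerA.
Qed.

End ExtMap.

Lemma ext_map_comp (J K : 'rV[R]_n -> 'rV[R]_n) a :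
  (forall u, J u = \sum_(i < n) u 0 i *: J (delta_mx 0 i)) ->
  ext_map J (ext_map K a) = ext_map (J \o K) a.
Proof.
move=> lJ; elim/ext_ind: a => [|a c ha hc|x a ha|S].
- by rewrite !ext_map0.
- by rewrite !ext_mapD ha hc.
- by rewrite !ext_mapZ ha.
elim/(@set_min_ind n): S => [|j S jS IH]; first by rewrite !ext_map1.
by rewrite !ext_map_basis_min // ext_map_mul IH ext_map_vec.
Qed.

Lemma ext_vec_delta j : ext_vec (delta_mx 0 j) = e [set j].
Proof.
rewrite /ext_vec (bigD1 j) //= mxE !eqxx scale1r big1 ?addr0 // => i ij.
by rewrite mxE (negPf ij) scale0r.
Qed.

Lemma ext_map_id (J : 'rV[R]_n -> 'rV[R]_n) a : (forall u, J u = u) -> ext_map J a = a.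
Proof.
move=> JK; elim/ext_ind: a => [|a c ha hc|x a ha|S].
- by rewrite !ext_map0.
- by rewrite !ext_mapD ha hc.
- by rewrite !ext_mapZ ha.
elim/(@set_min_ind n): S => [|j S jS IH]; first by rewrite !ext_map1.
by rewrite ext_map_basis_min // IH JK ext_vec_delta; have [_ ->] := ext_basis_min jS.
Qed.

End ExteriorAlgebraTheory.
Arguments ext_hom_basis {R n} S.

From mathcomp Require Import boolp classical_sets functions.
From mathcomp Require Import topology normedtype landau derive.
From mathcomp Require Import sequences exp realfun.
Import numFieldNormedType.Exports.
Local Open Scope classical_set_scope.
Local Open Scope ring_scope.

(** * Smooth functions *)

Section SmoothCalculus.
Context {R : realType}.

(** Differentiability depends only on the germ: the first-order expansion of [f] at [x] serves for
    [g], and [diff_unique] identifies the two differentials. *)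
Lemma near_eq_differentiable (V W : normedModType R) (f g : V -> W) (x : V) :
  (\near x, f x = g x) -> differentiable f x -> differentiable g x.
Proof.
move=> fg dfx; have fgx : f x = g x by exact: nbhs_singleton fg.
have [cf ef] := (diff_locallyP x f).1 dfx.
have eg : g \o shift x = cst (g x) + 'd f x +o_ (0 : V) (@id V).
  apply/eqaddoP => e e0; have /eqaddoP/(_ e e0) := ef.
  have : \forall y \near (0 : V), f (x + y) = g (x + y) by move: fg; rewrite nbhs0P.
  apply: filterS2 => y /= h1.
  by rewrite !fctE /= [y + x]addrC h1 fgx.
have dgf : 'd g x = 'd f x :> (V -> W) by exact: diff_unique.
apply/diff_locallyP; rewrite dgf; split => //.
Qed.

Variables (V : normedModType R).
Implicit Types (O : set V) (f g : V -> R).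

Lemma open_near O (W : normedModType R) (f g : V -> W) x : open O -> O x ->
  (forall y, O y -> f y = g y) -> \near x, f x = g x.
Proof. by move=> oO Ox fg; apply: filterS (open_nbhs_nbhs (conj oO Ox)) => y /fg. Qed.

(** Openness turns equality on [O] into equality of germs, so directional derivatives agree on [O]
    as well and the induction on [r] proceeds. *)
Lemma Cr_on_eq r O f g : open O -> (forall x, O x -> f x = g x) ->
  Cr_on r O f -> Cr_on r O g.
Proof.
move=> oO; elim: r f g => [|r IH] f g fg /=.
  move=> cf x Ox; have fgn := open_near oO Ox fg.
  move: (cf x Ox); rewrite /= /prop_for /continuous_at -?fg // => cfx.
  by apply: cvg_trans cfx; exact: near_eq_cvg.
move=> [df Df]; split=> [x Ox|v].
  exact: near_eq_differentiable (open_near oO Ox fg) (df x Ox).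
apply: IH (Df v) => x Ox; apply: near_eq_derive; exact: open_near fg.
Qed.

Lemma Cr_onS r O f : Cr_on r.+1 O f -> Cr_on r O f.
Proof.
elim: r f => [|r IH] f [df Df].
  by move=> x Ox; exact: differentiable_continuous (df x Ox).
by split=> // v; apply: IH.
Qed.

Lemma Cr_on_cst r O (a : R) : Cr_on r O (fun=> a).
Proof.
elim: r a => [|r IH] a; first by move=> x _; exact: cvg_cst.
split=> [x _|v]; first exact: differentiable_cst.
have -> : (fun x => 'D_v (fun=> a) x) = (fun=> 0) :> (V -> R); last exact: IH.
by apply/funext => x; rewrite derive_cst.
Qed.

Lemma Cr_onD r O f g : open O -> Cr_on r O f -> Cr_on r O g ->
  Cr_on r O (fun x => f x + g x).
Proof.
move=> oO; elim: r f g => [|r IH] f g.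
  by move=> cf cg x Ox; apply: cvgD; [exact: cf|exact: cg].
move=> [df Df] [dg Dg]; split=> [x Ox|v].
  exact: (differentiableD (df x Ox) (dg x Ox)).
apply: Cr_on_eq (IH _ _ (Df v) (Dg v)) => // x Ox.
by rewrite (@deriveD _ _ _ f g) //; apply: diff_derivable; [exact: df|exact: dg].
Qed.

Lemma Cr_onM r O f g : open O -> Cr_on r O f -> Cr_on r O g ->
  Cr_on r O (fun x => f x * g x).
Proof.
move=> oO; elim: r f g => [|r IH] f g.
  by move=> cf cg x Ox; apply: cvgM; [exact: cf|exact: cg].
move=> cf cg; have [[df Df] [dg Dg]] := (cf, cg); split=> [x Ox|v].
  exact: (differentiableM (df x Ox) (dg x Ox)).
apply: Cr_on_eq (Cr_onD oO (IH _ _ (Cr_onS cf) (Dg v)) (IH _ _ (Cr_onS cg) (Df v))) => // x Ox.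
rewrite (@deriveM _ _ f g) //; apply: diff_derivable; [exact: df|exact: dg].
Qed.

Lemma smooth_onD O f g : open O -> smooth_on O f -> smooth_on O g ->
  smooth_on O (fun x => f x + g x).
Proof. by move=> oO sf sg r; exact: Cr_onD. Qed.

Lemma smooth_onM O f g : open O -> smooth_on O f -> smooth_on O g ->
  smooth_on O (fun x => f x * g x).
Proof. by move=> oO sf sg r; exact: Cr_onM. Qed.

Lemma smooth_on_cst O (a : R) : smooth_on O (fun=> a).
Proof. by move=> r; exact: Cr_on_cst. Qed.

Lemma smooth_on_eq O f g : open O -> (forall x, O x -> f x = g x) ->
  smooth_on O f -> smooth_on O g.
Proof. by move=> oO fg sf r; exact: Cr_on_eq (sf r). Qed.

Lemma smooth_on_sum O (I : Type) (s : seq I) (P : pred I) (F : I -> V -> R) : open O ->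
  (forall i, P i -> smooth_on O (F i)) -> smooth_on O (fun x => \sum_(i <- s | P i) F i x).
Proof.
move=> oO sF; elim: s => [|i s IH].
  by apply: smooth_on_eq (smooth_on_cst O 0) => // x _; rewrite big_nil.
case Pi: (P i).
  by apply: smooth_on_eq (smooth_onD oO (sF i Pi) IH) => // x _; rewrite big_cons Pi.
by apply: smooth_on_eq IH => // x _; rewrite big_cons Pi.
Qed.

Lemma smooth_on_diff O (W : normedModType R) (f : V -> W) x :
  smooth_on O f -> O x -> differentiable f x.
Proof. by move=> sf Ox; have [df _] := sf 1%N; exact: df. Qed.

Lemma smooth_on_derive O (W : normedModType R) (f : V -> W) v : smooth_on O f ->
  smooth_on O (fun x => 'D_v f x).
Proof. by move=> sf r; have [_ Df] := sf r.+1; exact: Df. Qed.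

Lemma Cr_on_local r O f : (forall x, O x -> exists2 U : set V, open U /\ U x & Cr_on r U f) ->
  Cr_on r O f.
Proof.
elim: r f => [|r IH] f H; first by move=> x /H[U [_ Ux] cf]; exact: cf.
split=> [x /H[U [_ Ux] [df _]]|v]; first exact: df.
apply: IH => x /H[U oU [_ Df]]; exists U => //; exact: Df.
Qed.

Lemma smooth_on_local O f : (forall x, O x -> exists2 U : set V, open U /\ U x & smooth_on U f) ->
  smooth_on O f.
Proof. by move=> H r; apply: Cr_on_local => x /H[U oU sf]; exists U. Qed.

Lemma smooth_on_coord n O (h : V -> 'rV[R]_n) i : open O -> smooth_on O h ->
  smooth_on O (fun x => h x 0 i).
Proof.
move=> oO + r; elim: r h => [|r IH] h sh.
  move=> x Ox; apply: (@continuous_comp _ _ _ h (fun u => u 0 i)); first exact: sh 0%N x Ox.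
  exact: coord_continuous.
split=> [x Ox|v].
  exact: differentiable_comp (smooth_on_diff sh Ox) (differentiable_coord _ _ _).
apply: Cr_on_eq (IH _ (smooth_on_derive v sh)) => // x Ox.
by rewrite derive_mx ?mxE //; apply: diff_derivable; exact: smooth_on_diff sh Ox.
Qed.

End SmoothCalculus.

Section SmoothComp.
Context {R : realType} (V : normedModType R).
Implicit Types (O : set V) (f : V -> R).

Lemma derive_row_sum n (W : normedModType R) (g : 'rV[R]_n -> W) (y v : 'rV[R]_n) :
  differentiable g y ->
  'D_v g y = \sum_(i < n) v 0 i *: 'D_(delta_mx 0 i) g y.
Proof.
move=> dg; rewrite deriveE // {1}(row_sum_delta v) linear_sum.
by apply: eq_bigr => i _; rewrite linearZ deriveE.
Qed.

Lemma derive_comp_row n (W : normedModType R) (g : 'rV[R]_n -> W) (h : V -> 'rV[R]_n) x v :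
  differentiable h x -> differentiable g (h x) ->
  'D_v (g \o h) x = 'D_('D_v h x) g (h x).
Proof.
move=> dh dg; rewrite (deriveE v (differentiable_comp dh dg)) (deriveE _ dg).
by rewrite (deriveE v dh) (diff_comp dh dg).
Qed.

(** Induction on [r] with [g] general: the chain rule writes a derivative of the composite as a sum
    of products in which a partial derivative of [g], again smooth, is composed with [h]. *)
Lemma smooth_on_comp n O (O' : set 'rV[R]_n) (g : 'rV[R]_n -> R) (h : V -> 'rV[R]_n) :
  open O -> (forall x, O x -> O' (h x)) -> smooth_on O' g -> smooth_on O h ->
  smooth_on O (g \o h).
Proof.
move=> oO OO' + sh r; elim: r g => [|r IH] g sg.
  move=> x Ox; apply: continuous_comp; first exact: sh 0%N x Ox.
  by apply: sg 0%N _ _; exact: OO'.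
split=> [x Ox|v].
  have dg := smooth_on_diff sg (OO' _ Ox).
  have dh := smooth_on_diff sh Ox.
  exact: differentiable_comp dh dg.
pose F i x := ('D_v h x) 0 i * 'D_(delta_mx 0 i) g (h x).
suff H : Cr_on r O (fun x => \sum_(i < n) F i x).
  apply: Cr_on_eq H => // x Ox.
  rewrite (derive_comp_row _ (smooth_on_diff sh Ox) (smooth_on_diff sg (OO' _ Ox))).
  by rewrite derive_row_sum //; exact: smooth_on_diff sg (OO' _ Ox).
elim: (index_enum _) => [|i s IHs].
  by apply: Cr_on_eq (Cr_on_cst r O 0) => // x _; rewrite big_nil.
apply: (@Cr_on_eq _ _ _ _ (fun x => F i x + \sum_(j <- s) F j x)) => //.
  by move=> x _; rewrite big_cons.
apply: Cr_onD => //; apply: Cr_onM => //.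
  exact: (smooth_on_coord i oO (smooth_on_derive v sh)).
exact: IH (smooth_on_derive _ sg).
Qed.

End SmoothComp.

(** * The flat functions behind bump functions *)

Section Bump.
Context {R : realType}.
Implicit Types (t : R) (m : nat).

(* The family is closed under differentiation: flat m' = flat (m+2) - m flat (m+1). *)
Definition flat m t : R := if 0 < t then t^-1 ^+ m * expR (- t^-1) else 0.

Lemma flat_ge0 m t : 0 <= flat m t.
Proof.
rewrite /flat; case: ifP => // t0.
by rewrite mulr_ge0 ?expR_ge0 // exprn_ge0 // invr_ge0 ltW.
Qed.

(** For [u = t^-1 > 0], the exponential series gives [u ^+ m.+2 <= (m.+2)! * expR u]. A quadratic
    bound is what makes the difference quotient at 0 tend to 0. *)
Lemma flat_le m t : flat m t <= (m.+2)`!%:R * t ^+ 2.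
Proof.
rewrite /flat; case: ifP => [t0|_]; last by rewrite mulr_ge0 ?sqr_ge0.
have u0 : 0 < t^-1 by rewrite invr_gt0.
have := expR_ge1Dxn m.+1 (ltW u0); set f := _`!%:R => le.
have f0 : 0 < f by rewrite ltr0n fact_gt0.
have {}le : t^-1 ^+ m.+2 <= f * expR (t^-1).
  rewrite -ler_pdivrMl // mulrC; apply: le_trans le; by rewrite lerDr ler01.
rewrite expRN ler_pdivrMr ?expR_gt0 // -mulrA [t ^+ 2 * _]mulrC mulrA.
rewrite -ler_pdivrMr ?exprn_gt0 // -exprVn -exprD addn2; exact: le.
Qed.

Lemma flat_derive0 m : is_derive (0 : R) (1 : R) (flat m) 0.
Proof.
have f0 : flat m 0 = 0 by rewrite /flat ltxx.
have H : (fun h : R => h^-1 *: ((flat m \o shift 0) (h *: (1:R)) - flat m 0)) @ (0 : R)^'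
    --> (0 : R).
  apply/norm_cvg0P.
  (* By [flat_le] the absolute value of the difference quotient is at most [(m.+2)!] times that of
     [h]. *)
  apply: (@squeeze_cvgr _ _ _ _ (cst 0) (fun h : R => (m.+2)`!%:R * `|h|)).
  - near=> h; rewrite normr_ge0 /= addr0 f0 subr0 [h *: _]mulr1 normrM (ger0_norm (flat_ge0 _ _)).
    have h0 : h != 0 by near: h; exact: nbhs_dnbhs_neq.
    rewrite normfV ler_pdivrMl ?normr_gt0 // mulrCA -expr2 real_normK ?num_real //; exact: flat_le.
  - exact: cvg_cst.
  - rewrite -[X in _ --> X](mulr0 (m.+2)`!%:R); apply: cvgMr.
    rewrite -[X in _ --> X](normr0 R); apply: cvg_norm; exact: nbhs_dnbhs.
split; first by apply/cvg_ex; exists 0.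
exact: cvg_lim H.
Unshelve. all: by end_near. Qed.

Lemma flat_derive m t : is_derive t (1 : R) (flat m) (flat m.+2 t - m%:R * flat m.+1 t).
Proof.
have [t0|t0|->] := ltgtP t 0.
- have e : \near t, (cst 0 : R -> R) t = flat m t.
    near=> s; rewrite /flat; rewrite ifF //; apply/negbTE; rewrite -leNgt ltW //.
    by near: s; exact: lt_nbhsl.
  apply: (near_eq_is_derive e).
  rewrite /flat (lt_gtF t0) mulr0 subr0; exact: is_derive_cst.
- pose F s : R := s^-1 ^+ m * expR (- s^-1).
  have e : \near t, F t = flat m t.
    near=> s; rewrite /flat ifT //; near: s; exact: lt_nbhsr.
  apply: (near_eq_is_derive e).
  have tn0 : t != 0 by rewrite gt_eqF.
  have d1 : is_derive t (1:R) (fun s : R => s^-1) (- t ^- 2).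
    split; first by apply: derivableV => //; exact: derivable_id.
    by rewrite deriveV // derive_id [_ *: _]mulr1.
  have d2 : is_derive t (1:R) (fun s : R => expR (- s^-1)) (t ^- 2 * expR (- t^-1)).
    have d2 : is_derive t (1:R) (fun s : R => - s^-1) (t ^- 2).
      by rewrite -[t ^- 2]opprK; exact: is_deriveN.
    by rewrite mulrC; exact: (is_derive1_comp (is_derive_expR _) d2).
  have d3 : is_derive t (1:R) (fun s : R => (s^-1) ^+ m) (m%:R * t^-1 ^+ m.-1 * (- t ^- 2)).
    have -> : (fun s : R => s^-1 ^+ m) = (fun s : R => s^-1) ^+ m.
      by apply/funext => s; rewrite exprfctE.
    exact: is_deriveX.
  apply: (is_derive_eq (is_deriveM d3 d2)).
  rewrite /flat t0 /=.
  rewrite /GRing.scale /= -!exprVn; case: m @F e d3 => [|m] F e d3 /=; rewrite ?exprS; ring.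
- rewrite /flat ltxx mulr0 subr0; exact: flat_derive0.
Unshelve. all: by end_near. Qed.

Lemma flat_gt0 t : 0 < t -> 0 < flat 0 t.
Proof. by move=> t0; rewrite /flat t0 expr0 mul1r expR_gt0. Qed.

Lemma flat_differentiable m t : differentiable (flat m) t.
Proof. by apply/derivable1_diffP; exact: (@ex_derive _ _ _ _ _ _ _ (flat_derive m t)). Qed.

(** The induction on [r] runs over all [m] at once, because differentiating [flat m] brings in
    [flat m.+1] and [flat m.+2]. *)
Lemma smooth_on_flat (V : normedModType R) (O : set V) (q : V -> R) m :
  open O -> smooth_on O q -> smooth_on O (fun x => flat m (q x)).
Proof.
move=> oO sq r; elim: r m => [|r IH] m.
  move=> x Ox; apply: (@continuous_comp _ _ _ q (flat m)); first exact: sq 0%N x Ox.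
  exact: differentiable_continuous (flat_differentiable _ _).
split=> [x Ox|v].
  exact: differentiable_comp (smooth_on_diff sq Ox) (flat_differentiable _ _).
have H : Cr_on r O (fun x => 'D_v q x * (flat m.+2 (q x) + (- m%:R) * flat m.+1 (q x))).
  apply: Cr_onM => //; first exact: smooth_on_derive.
  apply: Cr_onD => //; apply: Cr_onM => //; exact: Cr_on_cst.
apply: Cr_on_eq H => // x Ox.
have dq := smooth_on_diff sq Ox.
rewrite (deriveE v (differentiable_comp dq (flat_differentiable m (q x)))).
rewrite (diff_comp dq (flat_differentiable m (q x))) /= -(deriveE v dq).
rewrite -[X in 'd _ _ X]mulr1 -[_ * 1]/(_ *: (1:R)) linearZ /=; congr (_ * _).
rewrite -(deriveE _ (flat_differentiable m (q x))).
by rewrite (@derive_val _ _ _ _ _ _ _ (flat_derive m (q x))) mulNr.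
Qed.

End Bump.

(** * Coordinates on a manifold *)

Section ExtPartial.
Context {R : realType} {n : nat}.
Implicit Types (g h : 'rV[R]_n -> ext R n) (x : 'rV[R]_n).

Definition ext_differentiable g x := forall S, differentiable (fun y => g y S) x.

Lemma derivable_comp g x v S : ext_differentiable g x -> derivable (fun y => g y S) x v.
Proof. by move=> dg; exact: diff_derivable (dg S). Qed.

Lemma eq_ext_partial i g h x : (\near x, g x = h x) -> ext_partial i g x = ext_partial i h x.
Proof.
move=> gh; apply/ffunP => S; rewrite !ffunE; apply: near_eq_derive.
by apply: filterS gh => y ->.
Qed.

Lemma ext_differentiable_cst a x : ext_differentiable (fun=> a) x.
Proof. by move=> S; exact: differentiable_cst. Qed.

Lemma ext_partial_cst i a x : ext_partial i (fun=> a) x = 0.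
Proof. by apply/ffunP => S; rewrite !ffunE derive_cst. Qed.

Lemma ext_partialD i g h x : ext_differentiable g x -> ext_differentiable h x ->
  ext_partial i (fun y => g y + h y) x = ext_partial i g x + ext_partial i h x.
Proof.
move=> dg dh; apply/ffunP => S; rewrite !ffunE.
under eq_fun do rewrite ffunE.
by rewrite (@deriveD _ _ _ (fun y => g y S) (fun y => h y S)) //; exact: derivable_comp.
Qed.

Lemma derive_sum_seq (I : Type) (s : seq I) (P : pred I) (F : I -> 'rV[R]_n -> R) x v :
  (forall i, P i -> differentiable (F i) x) ->
  differentiable (fun y => \sum_(i <- s | P i) F i y) x /\
  'D_v (fun y => \sum_(i <- s | P i) F i y) x = \sum_(i <- s | P i) 'D_v (F i) x.
Proof.
move=> dF; elim: s => [|i s [IH1 IH2]].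
  rewrite big_nil; under eq_fun do rewrite big_nil.
  by rewrite derive_cst; split => //; exact: differentiable_cst.
rewrite big_cons; case: (boolP (P i)) => Pi; last first.
  by under eq_fun do rewrite big_cons (negPf Pi).
under eq_fun do rewrite big_cons Pi.
split; first exact: (differentiableD (dF i Pi) IH1).
rewrite (@deriveD _ _ _ (F i) (fun y => \sum_(j <- s | P j) F j y)) ?IH2 //.
  exact: diff_derivable (dF i Pi).
exact: diff_derivable IH1.
Qed.

Lemma differentiable_sum_seq (I : Type) (s : seq I) (P : pred I) (F : I -> 'rV[R]_n -> R) x :
  (forall i, P i -> differentiable (F i) x) ->
  differentiable (fun y => \sum_(i <- s | P i) F i y) x.
Proof. by move=> dF; have [] := derive_sum_seq s 0 dF. Qed.

Lemma ext_partial_mul i g h x : ext_differentiable g x -> ext_differentiable h x ->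
  ext_differentiable (fun y => ext_mul (g y) (h y)) x /\
  ext_partial i (fun y => ext_mul (g y) (h y)) x =
  ext_mul (ext_partial i g x) (h x) + ext_mul (g x) (ext_partial i h x).
Proof.
move=> dg dh.
have dM (s : R) S T : differentiable (fun y => s * g y S * h y T) x.
  apply: (differentiableM _ (dh T)); apply: (differentiableM _ (dg S)).
  exact: differentiable_cst.
split=> [S|].
  under eq_fun do rewrite ext_mulE.
  by apply: differentiable_sum_seq => T _; exact: dM.
apply/ffunP => S; rewrite !ffunE; under eq_fun do rewrite ext_mulE.
rewrite (derive_sum_seq _ _ (fun T _ => dM _ T _)).2.
rewrite -big_split; apply: eq_bigr => T _ /=; rewrite !ffunE.
have d1 : derivable (fun y => g y T) x (delta_mx 0 i) by exact: derivable_comp.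
have d2 : derivable (fun y => h y (S :\: T)) x (delta_mx 0 i) by exact: derivable_comp.
set s := _ ^+ _.
have d3 : derivable (fun y => s * g y T) x (delta_mx 0 i).
  exact: (@derivableZ _ _ _ (fun y => g y T) s x _ d1).
rewrite (@deriveM _ _ (fun y => s * g y T) (fun y => h y (S :\: T))) //.
rewrite (@deriveZ _ _ _ (fun y => g y T) s) //.
by rewrite /GRing.scale /=; ring.
Qed.

Lemma ext_partial_contract i g h x : ext_differentiable g x -> ext_differentiable h x ->
  ext_partial i (fun y => ext_contract (g y) (h y)) x =
  ext_contract (ext_partial i g x) (h x) + ext_contract (g x) (ext_partial i h x).
Proof.
move=> dg dh; apply/ffunP => S; rewrite !ffunE.
have [dm pm] := ext_partial_mul i dg (ext_differentiable_cst (ext_basis S) x).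
under eq_fun do rewrite ffunE /ext_pair.
have dhm T : differentiable (fun y => h y T * ext_mul (g y) (ext_basis S) T) x.
  exact: (differentiableM (dh T) (dm T)).
rewrite (derive_sum_seq _ _ (fun T _ => dhm T)).2.
rewrite /ext_pair -big_split; apply: eq_bigr => T _ /=.
have d1 : derivable (fun y => h y T) x (delta_mx 0 i) by exact: derivable_comp.
have d2 : derivable (fun y => ext_mul (g y) (ext_basis S) T) x (delta_mx 0 i).
  exact: diff_derivable (dm T).
rewrite (@deriveM _ _ (fun y => h y T) (fun y => ext_mul (g y) (ext_basis S) T)) //.
move/ffunP/(_ T): pm; rewrite ext_partial_cst ext_mul0r addr0 ffunE => ->.
by rewrite /ext_partial !ffunE /GRing.scale /= [X in _ + X]mulrC.
Qed.

End ExtPartial.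

Section Manifold.
Context {R : realType} {n : nat} {M : manifold R n}.
Implicit Types (c : chart R n M) (p q : M) (f : M -> R) (P Q X Y w : field M).

Lemma chart_at_atlas p : atlas (chart_at p). Proof. by rewrite /chart_at; case: cid => c []. Qed.
Lemma chart_at_dom p : cdom (chart_at p) p. Proof. by rewrite /chart_at; case: cid => c []. Qed.
Hint Resolve chart_at_atlas chart_at_dom : core.

Lemma cimg_map c p : cdom c p -> cimg c (cmap c p). Proof. by move=> cp; exists p. Qed.

Lemma cinv_dom c x : cimg c x -> cdom c (cinv c x).
Proof. by move=> [p cp <-]; rewrite cmapK. Qed.

Lemma cinvK c x : cimg c x -> cmap c (cinv c x) = x.
Proof. by move=> [p cp <-]; rewrite cmapK. Qed.

Definition overlap c c' := cmap c @` (cdom c `&` cdom c').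

Lemma overlapP c c' x : overlap c c' x <-> cimg c x /\ cdom c' (cinv c x).
Proof.
split=> [[p [cp c'p] <-]|[cx c'x]]; first by rewrite cmapK //; split => //; exists p.
by exists (cinv c x); rewrite ?cinvK //; split => //; exact: cinv_dom.
Qed.

(** Continuity of [cinv c] is known only at points of [cimg c], which is itself open; hence the
    intersection. *)
Lemma open_cinv_preimage c (B : set M) : open B -> open [set x | cimg c x /\ B (cinv c x)].
Proof.
move=> oB; rewrite openE => x [cx Bx]; rewrite /interior.
have n1 : \near x, cimg c x by apply: open_nbhs_nbhs; split => //; exact: cimg_open.
have n2 : \near x, B (cinv c x).
  by apply: (@cinv_continuous _ _ _ c x cx); apply: open_nbhs_nbhs; split.
by apply: filterS2 n1 n2 => y ? ?.
Qed.

Lemma open_overlap c c' : open (overlap c c').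
Proof.
suff -> : overlap c c' = [set x | cimg c x /\ cdom c' (cinv c x)].
  exact: open_cinv_preimage (@cdom_open _ _ _ c').
by apply/seteqP; split=> x /overlapP.
Qed.

Lemma overlap_map c c' p : cdom c p -> cdom c' p -> overlap c c' (cmap c p).
Proof. by move=> cp c'p; exists p. Qed.

Lemma smooth_transition c c' : atlas c -> atlas c' ->
  smooth_on (overlap c c') (cmap c' \o cinv c).
Proof. exact: atlas_compat. Qed.

Lemma overlap_transition c c' x : overlap c c' x -> overlap c' c (cmap c' (cinv c x)).
Proof. by move=> /overlapP[cx c'x]; apply: overlap_map => //; exact: cinv_dom. Qed.

Lemma differentiable_transition c c' p : atlas c -> atlas c' -> cdom c p -> cdom c' p ->
  differentiable (cmap c' \o cinv c) (cmap c p).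
Proof.
move=> ac ac' cp c'p; exact: smooth_on_diff (smooth_transition ac ac') (overlap_map cp c'p).
Qed.

Lemma transition_sum c c' p (u : 'rV[R]_n) : atlas c -> atlas c' -> cdom c p -> cdom c' p ->
  transition c c' p u = \sum_(i < n) u 0 i *: transition c c' p (delta_mx 0 i).
Proof. by move=> *; apply: derive_row_sum; exact: differentiable_transition. Qed.

(** The cocycle rule is the chain rule: near [cmap c p] the composite of the two coordinate changes
    is the direct one. *)
Lemma transition_comp c c' c'' p (u : 'rV[R]_n) : atlas c -> atlas c' -> atlas c'' ->
  cdom c p -> cdom c' p -> cdom c'' p ->
  transition c' c'' p (transition c c' p u) = transition c c'' p u.
Proof.
move=> ac ac' ac'' cp c'p c''p.
have e : cmap c' p = (cmap c' \o cinv c) (cmap c p) by rewrite /= cmapK.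
rewrite /transition [in LHS]e -derive_comp_row; first last.
- by rewrite -e; exact: differentiable_transition.
- exact: differentiable_transition.
apply: near_eq_derive; apply: (open_near (@open_overlap c c') (overlap_map cp c'p)).
by move=> x /overlapP[cx c'x]; rewrite /= cmapK.
Qed.

Lemma transition_id c p (u : 'rV[R]_n) : cdom c p -> transition c c p u = u.
Proof.
move=> cp; rewrite /transition -[RHS](derive_id (cmap c p)); apply: near_eq_derive.
by apply: (open_near (@cimg_open _ _ _ c) (cimg_map cp)) => x cx; exact: cinvK.
Qed.

Lemma ext_map_transition c c' c'' p a : atlas c -> atlas c' -> atlas c'' ->
  cdom c p -> cdom c' p -> cdom c'' p ->
  ext_map (transition c' c'' p) (ext_map (transition c c' p) a) = ext_map (transition c c'' p) a.
Proof.
move=> ac ac' ac'' cp c'p c''p; rewrite ext_map_comp => [|u]; last exact: transition_sum.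
by congr (ext_map _ a); apply/funext => u; exact: transition_comp.
Qed.

Lemma ext_map_transition_id c p a : cdom c p -> ext_map (transition c c p) a = a.
Proof. by move=> cp; apply: ext_map_id => u; exact: transition_id. Qed.

Lemma mv_coord_wedge c P Q x :
  mv_coord c (wedge P Q) x = ext_mul (mv_coord c P x) (mv_coord c Q x).
Proof. exact: ext_map_mul. Qed.

Lemma mv_coordD c P Q x : mv_coord c (P + Q) x = mv_coord c P x + mv_coord c Q x.
Proof. exact: ext_mapD. Qed.

Lemma mv_coord_fn c f x : mv_coord c (fn f) x = f (cinv c x) *: ext_basis finset.set0.
Proof. by rewrite /mv_coord /fn ext_mapZ ext_map1. Qed.

(** The value at [p] is stored in the components of [chart_at p], and the transition from a chart to
    itself is the identity. Working at [p] in this chart thus removes all changes of coordinates. *)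
Lemma mv_coord_center P p : mv_coord (chart_at p) P (cmap (chart_at p) p) = P p.
Proof. by rewrite /mv_coord cmapK // ext_map_transition_id. Qed.

Lemma ext_pair_form_coord c w x a : ext_pair (form_coord c w x) a =
  ext_pair (w (cinv c x)) (ext_map (transition c (chart_at (cinv c x)) (cinv c x)) a).
Proof.
elim/(@ext_ind R n): a => [|a b ha hb|y a ha|S].
- by rewrite ext_map0 !ext_pair0r.
- by rewrite ext_mapD !ext_pairDr ha hb.
- by rewrite ext_mapZ !ext_pairZr ha.
- by rewrite ext_pair_basis ffunE.
Qed.

Lemma form_coord_center w p : form_coord (chart_at p) w (cmap (chart_at p) p) = w p.
Proof.
apply: ext_pair_inj => S; rewrite ext_pair_form_coord cmapK // ext_map_transition_id //.
Qed.

(** Form coordinates are dual to the transported basis, so after pairing with a basis element the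
    claim is multiplicativity and functoriality of [ext_map]. *)
Lemma form_coord_iprod c P w x : atlas c -> cimg c x ->
  form_coord c (iprod P w) x = ext_contract (mv_coord c P x) (form_coord c w x).
Proof.
move=> ac cx; have cq := cinv_dom cx; apply: ext_pair_inj => S.
rewrite ext_pair_contract !ext_pair_form_coord ext_pair_contract ext_map_mul.
by rewrite /mv_coord ext_map_transition // ext_map_transition_id.
Qed.

End Manifold.

(** * Bump functions and frames *)

Section BumpRow.
Context {R : realType} {n : nat}.

Lemma smooth_on_row_coord (O : set 'rV[R]_n) (i : 'I_n) :
  open O -> smooth_on O (fun x : 'rV[R]_n => x 0 i).
Proof.
move=> oO [|r]; first by move=> x _; exact: coord_continuous.
split=> [x _|v]; first exact: differentiable_coord.
apply: Cr_on_eq (Cr_on_cst r O (v 0 i)) => // x _.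
have : derivable (@id 'rV[R]_n) x v by exact: derivable_id.
by move/derive_mx; rewrite derive_id => /matrixP/(_ 0 i); rewrite mxE => ->.
Qed.

Lemma row_bump (O : set 'rV[R]_n) (x0 : 'rV[R]_n) : open O -> O x0 ->
  exists (b : 'rV[R]_n -> R) (K : set 'rV[R]_n),
    [/\ forall U, open U -> smooth_on U b, b x0 = 1, compact K, K `<=` O &
        forall x, b x != 0 -> K x].
Proof.
move=> oO Ox0; have /nbhs_ballP[e /= e0 eO] := open_nbhs_nbhs (conj oO Ox0).
(* With half the radius, the closed cube around [x0], compact as a product of closed intervals, lies
   in the open ball of radius [e] for the sup norm. *)
pose r := e / 2; have r0 : 0 < r by rewrite divr_gt0.
(* Positive only within Euclidean distance [r] of [x0], hence only inside the cube. Division by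
   [flat 0 (r ^+ 2)] below normalises the value at [x0] to 1. *)
pose q (x : 'rV[R]_n) : R := r ^+ 2 + (-1) * \sum_(i < n) (x 0 i + - x0 0 i) * (x 0 i + - x0 0 i).
have qx0 : q x0 = r ^+ 2.
  by rewrite /q big1 ?mulr0 ?addr0 // => i _; rewrite subrr mulr0.
have b0 : 0 < flat 0 (r ^+ 2) by rewrite flat_gt0 // exprn_gt0.
exists (fun x => flat 0 (q x) * (flat 0 (r ^+ 2))^-1).
exists [set x | forall i, closed_ball (x0 0 i) r (x 0 i)]; split.
- move=> U oU; apply: smooth_onM => //; last exact: smooth_on_cst.
  apply: smooth_on_flat => //; apply: smooth_onD => //; first exact: smooth_on_cst.
  apply: smooth_onM => //; first exact: smooth_on_cst.
  apply: smooth_on_sum => // i _.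
  have s : smooth_on U (fun x : 'rV[R]_n => x 0 i + - x0 0 i).
    apply: smooth_onD => //; [exact: smooth_on_row_coord|exact: smooth_on_cst].
  exact: smooth_onM.
- by rewrite qx0 divff // gt_eqF.
- apply: (@rV_compact _ _ (fun i => closed_ball (x0 0 i) r)) => i.
  exact: closed_ballR_compact.
- move=> x Kx; apply: eO; split=> // i j; rewrite ord1.
  have := Kx j; rewrite closed_ballE // /closed_ball_ /= => le.
  apply: le_lt_trans le _; rewrite /r; lra.
- move=> x; rewrite mulf_eq0 negb_or => /andP[+ _] i.
  rewrite /flat; case: ifP => [|]; last by rewrite eqxx.
  rewrite /q mulN1r subr_gt0 => lt _.
  rewrite closed_ballE // /closed_ball_ /=.
  rewrite -(ler_pXn2r (n:=2)) ?nnegrE ?(ltW r0) // real_normK ?num_real //.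
  apply: le_trans (ltW lt); rewrite (bigD1 i) //= -expr2 -sqrrN opprB lerDl.
  by apply: sumr_ge0 => j _; rewrite -expr2 sqr_ge0.
Qed.

End BumpRow.

(** * Cut-off coordinate frames and induction on multivector fields *)

Section Frames.
Context {R : realType} {n : nat} {M : manifold R n}.
Implicit Types (c : chart R n M) (p q : M) (f : M -> R) (P Q X Y w : field M).
Hint Resolve chart_at_atlas chart_at_dom : core.



(** The last property lets functions smooth on the chart domain be extended by zero after
    multiplication by [phi]. It holds because [phi] vanishes off a compact part of the domain, which
    is closed in [M] as [M] is Hausdorff. *)
Lemma bump_extension c p : atlas c -> cdom c p -> exists phi : M -> R,
  [/\ phi p = 1, forall q, ~ cdom c q -> phi q = 0 &
      forall c' (G : 'rV[R]_n -> R), atlas c' -> smooth_on (overlap c' c) G ->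
        smooth_on (cimg c') (fun x => phi (cinv c' x) * G x)].
Proof.
move=> ac cp; have [b [K [sb b1 cK KO bK]]] := row_bump (@cimg_open _ _ _ c) (cimg_map cp).
pose phi q := if `[< cdom c q >] then b (cmap c q) else 0.
pose KM := cinv c @` K.
have clK : closed KM.
  apply: compact_closed; first exact: mspace_hausdorff.
  apply: continuous_compact => //; apply: continuous_in_subspaceT => x /set_mem Kx.
  exact: (@cinv_continuous _ _ _ c x (KO _ Kx)).
exists phi; split.
- by rewrite /phi asboolT.
- by move=> q nq; rewrite /phi asboolF.
move=> c' G ac' sG; apply: smooth_on_local => x c'x.
have [cq|ncq] := pselect (cdom c (cinv c' x)).
  exists (overlap c' c); first by split; [exact: open_overlap|apply/overlapP].
  apply: (@smooth_on_eq _ _ _ (fun x => (b \o (cmap c \o cinv c')) x * G x)).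
  - exact: open_overlap.
  - by move=> y /overlapP[_ cy]; rewrite /phi asboolT.
  apply: smooth_onM => //; first exact: open_overlap.
  apply: (@smooth_on_comp _ _ _ _ setT); [exact: open_overlap|by []|exact: sb openT|].
  exact: smooth_transition.
(* A point outside the domain of [c] lies off the closed set [KM], and the product vanishes on the
   whole open complement of [KM]. *)
exists [set y | cimg c' y /\ (~` KM) (cinv c' y)].
  split; first by apply: open_cinv_preimage; rewrite openC.
  split => //= -[y Ky yq]; apply: ncq; rewrite -yq; exact: cinv_dom (KO _ Ky).
apply: (@smooth_on_eq _ _ _ (fun=> 0)); last exact: smooth_on_cst.
  by apply: open_cinv_preimage; rewrite openC.
move=> y [c'y nK]; rewrite /phi; case: asboolP => cy; rewrite ?mul0r //.
case: (eqVneq (b (cmap c (cinv c' y))) 0) => [->|/bK Ky]; first by rewrite mul0r.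
by case: nK; exists (cmap c (cinv c' y)); rewrite ?cmapK.
Qed.

Lemma smooth_funM f g : smooth_fun f -> smooth_fun g -> smooth_fun (fun q : M => f q * g q).
Proof. by move=> sf sg c ac; apply: smooth_onM (sf c ac) (sg c ac); exact: cimg_open. Qed.

Lemma smooth_fun_cst (a : R) : smooth_fun ((fun=> a) : M -> R).
Proof. by move=> c ac; exact: smooth_on_cst. Qed.

Lemma smooth_funX f m : smooth_fun f -> smooth_fun (fun q : M => f q ^+ m).
Proof.
move=> sf; elim: m => [|m IH]; first exact: smooth_fun_cst.
by under eq_fun do rewrite exprS; exact: smooth_funM.
Qed.

Lemma multivectorD P Q : multivector P -> multivector Q -> multivector (P + Q).
Proof.
move=> sP sQ c ac S; under eq_fun do rewrite mv_coordD ffunE.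
by apply: smooth_onD (sP c ac S) (sQ c ac S); exact: cimg_open.
Qed.

Lemma multivector0 : multivector (0 : field M).
Proof.
move=> c ac S; under eq_fun do rewrite /mv_coord ext_map0 ffunE.
exact: smooth_on_cst.
Qed.

Lemma multivector_fn f : smooth_fun f -> multivector (fn f : field M).
Proof.
move=> sf c ac S; under eq_fun do rewrite mv_coord_fn ffunE.
apply: smooth_onM (sf c ac) _; [exact: cimg_open|exact: smooth_on_cst].
Qed.

Lemma multivector_wedge P Q : multivector P -> multivector Q -> multivector (wedge P Q).
Proof.
move=> sP sQ c ac S; under eq_fun do rewrite mv_coord_wedge ext_mulE.
apply: smooth_on_sum => [|T _]; first exact: cimg_open.
apply: smooth_onM (sQ c ac _); first exact: cimg_open.
apply: smooth_onM (sP c ac _); first exact: cimg_open.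
exact: smooth_on_cst.
Qed.

Lemma A_wedge (k l : int) P Q : A k P -> A l Q -> A (k + l) (wedge P Q).
Proof.
move=> [sP hP] [sQ hQ]; split; first exact: multivector_wedge.
by move=> p; apply: ext_hom_mul; [exact: hP|exact: hQ].
Qed.

Lemma A_fn f : smooth_fun f -> A 0 (fn f : field M).
Proof.
move=> sf; split=> [|p]; first exact: multivector_fn.
by apply: ext_homZ; have := @ext_hom_basis R n finset.set0; rewrite cards0.
Qed.

Lemma A_lt0 (k : int) P : A k P -> k < 0 -> P = 0.
Proof. by move=> [_ hP] k0; apply/funext => p; exact: ext_hom_lt0 (hP p) k0. Qed.

Lemma fscaleE f P : fscale f P = wedge (fn f) P.
Proof. by apply/funext => p; rewrite /wedge ext_mulZl ext_mul1l. Qed.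

Lemma A0_fn P : A 0 P -> exists2 f, smooth_fun f & P = fn f.
Proof.
move=> [sP hP]; have PE : P = fn (fun q => P q finset.set0).
  apply/funext => q; apply/ffunP => S; rewrite !ffunE.
  have [->|S0] := eqVneq S finset.set0; first by rewrite [_ *: _]mulr1.
  by rewrite scaler0 hP // => /eqP; rewrite eqz_nat cards_eq0 (negPf S0).
exists (fun q => P q finset.set0) => // c ac.
apply: smooth_on_eq (sP c ac finset.set0); first exact: cimg_open.
by move=> x cx; rewrite [in LHS]PE mv_coord_fn !ffunE eqxx [_ *: _]mulr1.
Qed.

Lemma wedge_bigE (I : finType) (S : {set I}) (E : I -> field M) q :
  (\big[wedge/fn (fun=> 1)]_(i in S) E i) q =
  \big[ext_mul/ext_basis finset.set0]_(i in S) E i q.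
Proof. by apply: (big_morph (fun P : field M => P q)) => [//|]; exact: scale1r. Qed.

Lemma ext_map_scale (a : R) (J : 'rV[R]_n -> 'rV[R]_n) (S : {set 'I_n}) :
  \big[ext_mul/ext_basis finset.set0]_(i in S) (a *: ext_vec (J (delta_mx 0 i))) =
  a ^+ #|S| *: ext_map J (ext_basis S).
Proof.
have vZ u : a *: ext_vec u = ext_vec (a *: u : 'rV[R]_n).
  by rewrite scaler_sumr; apply: eq_bigr => i _; rewrite mxE scalerA.
under eq_bigr do rewrite vZ.
rewrite -(ext_map_basis (fun u => a *: J u)).
elim/(@set_min_ind n): S => [|j S jS IH]; first by rewrite !ext_map1 cards0 scale1r.
rewrite !ext_map_basis_min // IH -vZ ext_mulZl ext_mulZr scalerA -exprS.
by rewrite cardsU1 (ext_basis_min jS).1.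
Qed.

Section LocalFrame.
Variables (p : M) (phi : M -> R).
Let c := chart_at p.
Hypothesis phip : phi p = 1.
Hypothesis phi_out : forall q, ~ cdom c q -> phi q = 0.
Hypothesis phi_smooth : forall c' (G : 'rV[R]_n -> R), atlas c' ->
  smooth_on (overlap c' c) G -> smooth_on (cimg c') (fun x => phi (cinv c' x) * G x).

Let ac : atlas c. Proof. exact: chart_at_atlas. Qed.

(** The i-th coordinate vector field of [c], written in the components of [chart_at q] and cut off
    by [phi]. *)
Definition frame_vec (i : 'I_n) : field M := fun q =>
  phi q *: ext_vec (transition c (chart_at q) q (delta_mx 0 i)).

Definition frame (S : {set 'I_n}) : field M :=
  \big[wedge/fn (fun=> 1)]_(i in S) frame_vec i.

Lemma smooth_fun_bump : smooth_fun phi.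
Proof.
move=> c' ac'; have := phi_smooth ac' (smooth_on_cst _ (1 : R)).
by under eq_fun do rewrite mulr1.
Qed.

Lemma A_frame_vec i : A 1 (frame_vec i).
Proof.
split=> [c' ac' S|q]; last by apply: ext_homZ; exact: ext_vec_hom.
pose G x := ext_vec (transition c c' (cinv c' x) (delta_mx 0 i)) S.
apply: (@smooth_on_eq _ _ _ (fun x => phi (cinv c' x) * G x)).
- exact: cimg_open.
- move=> x c'x; rewrite /mv_coord /frame_vec ext_mapZ ffunE.
  have [cq|ncq] := pselect (cdom c (cinv c' x)); last by rewrite phi_out // mul0r scale0r.
  have c'q := cinv_dom c'x.
  rewrite ext_map_vec; last exact: transition_sum.
  by rewrite transition_comp.
apply: phi_smooth => //; rewrite /G.
under eq_fun do rewrite ext_vecE.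
have oo := @open_overlap _ _ _ c' c.
apply: smooth_on_sum => // j _; apply: smooth_onM => //; last exact: smooth_on_cst.
(* The Jacobian is smooth as a function of the coordinates of [c]; it is then pulled back to those
   of [c'] by the coordinate change. *)
have sD := smooth_on_derive (delta_mx 0 i) (smooth_transition ac ac').
have sDj := smooth_on_coord j (@open_overlap _ _ _ c c') sD.
have := smooth_on_comp oo _ sDj (smooth_transition ac' ac); apply=> x.
exact: overlap_transition.
Qed.

Lemma frameE S q :
  frame S q = phi q ^+ #|S| *: ext_map (transition c (chart_at q) q) (ext_basis S).
Proof. by rewrite /frame wedge_bigE -ext_map_scale. Qed.

Lemma frame_center S : frame S p = ext_basis S.
Proof.
rewrite frameE phip expr1n scale1r; exact: (ext_map_transition_id _ (chart_at_dom p)).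
Qed.

Lemma A_frame (S : {set 'I_n}) : A #|S| (frame S).
Proof.
split=> [|q]; last by rewrite frameE; apply: ext_homZ; apply: ext_map_hom; exact: ext_hom_basis.
apply: (big_rec (fun P : field M => multivector P)) => [|i P _ sP].
  exact: multivector_fn (smooth_fun_cst _).
by apply: multivector_wedge => //; exact: (A_frame_vec i).1.
Qed.

(* The powers of [phi] in [frame S] and in its coefficient add up to n + 1,
   whatever the degree of [S]. *)
Definition frame_coef X (S : {set 'I_n}) : M -> R := fun q =>
  phi q ^+ (n - #|S|) * (phi q * mv_coord c X (cmap c q) S).

Lemma smooth_frame_coef X S : multivector X -> smooth_fun (frame_coef X S).
Proof.
move=> sX; apply: smooth_funM; first exact: smooth_funX smooth_fun_bump.
move=> c' ac'; apply: (phi_smooth ac' (G := fun x => mv_coord c X (cmap c (cinv c' x)) S)).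
have := smooth_on_comp (@open_overlap _ _ _ c' c) _ (sX c ac S) (smooth_transition ac' ac).
by apply=> x /overlapP[_ cx]; exact: cimg_map.
Qed.

Lemma frame_decomp X :
  fscale (fun q => phi q ^+ n.+1) X = \sum_S wedge (fn (frame_coef X S)) (frame S).
Proof.
apply/funext => q; rewrite fct_sumE /fscale.
under eq_bigr do rewrite -fscaleE /fscale frameE /frame_coef scalerA.
have le (S : {set 'I_n}) : (#|S| <= n)%N by rewrite -[n in (_ <= n)%N]card_ord max_card.
(* Off the chart the left side vanishes because [n.+1] is positive, and the right side because of
   the separate factor [phi] in [frame_coef], present in every degree. *)
have [cq|ncq] := pselect (cdom c q); last first.
  rewrite phi_out // expr0n scale0r big1 // => S _.
  by rewrite mul0r mulr0 mul0r scale0r.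
transitivity (phi q ^+ n.+1 *: ext_map (transition c (chart_at q) q) (mv_coord c X (cmap c q))).
  by rewrite /mv_coord cmapK // ext_map_transition // ext_map_transition_id.
rewrite {1}(ext_decomp (mv_coord c X (cmap c q))) ext_map_sum scaler_sumr.
apply: eq_bigr => S _; rewrite ext_mapZ scalerA; congr (_ *: _).
rewrite -{1}(subnK (le S)) exprS exprD; ring.
Qed.

End LocalFrame.

(** Functions and vector fields generate only after cutting off. The last closure condition undoes
    the cut-off by a function equal to 1 at [p], so [Phi] is meant to be a statement about values at
    [p]. *)
Lemma multivector_ind p (Phi : field M -> Prop) :
  (forall P Q, multivector P -> multivector Q -> Phi P -> Phi Q -> Phi (P + Q)) ->
  (forall f, smooth_fun f -> Phi (fn f)) -> (forall V, A 1 V -> Phi V) ->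
  (forall (k : int) P Q, A k P -> multivector Q -> Phi P -> Phi Q -> Phi (wedge P Q)) ->
  (forall f X, smooth_fun f -> f p = 1 -> multivector X -> Phi (fscale f X) -> Phi X) ->
  forall X, multivector X -> Phi X.
Proof.
move=> PD Pf PV PM Pc X sX.
have [phi [phi1 phi0 sphi]] := bump_extension (chart_at_atlas p) (chart_at_dom p).
pose psi q := phi q ^+ n.+1.
have spsi : smooth_fun psi by exact: smooth_funX (smooth_fun_bump sphi).
apply: (Pc psi X) => //; first by rewrite /psi phi1 expr1n.
rewrite (frame_decomp phi0).
(* Smoothness of the partial sums is carried along with [Phi], since closure under sums asks for
   it. *)
suff : forall s : seq {set 'I_n},
  multivector (\sum_(S <- s) wedge (fn (frame_coef p phi X S)) (frame p phi S)) /\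
  Phi (\sum_(S <- s) wedge (fn (frame_coef p phi X S)) (frame p phi S)) by move=> H; exact: (H _).2.
have P0 : Phi 0.
  have -> : 0 = fn (fun=> 0) :> field M by apply/funext => q; rewrite /fn scale0r.
  exact: Pf (smooth_fun_cst 0).
elim=> [|S s [sI PI]]; first by rewrite big_nil; split => //; exact: multivector0.
have sF := smooth_frame_coef sphi S sX.
have mF := multivector_wedge (multivector_fn sF) (A_frame phi0 sphi S).1.
rewrite big_cons; split; first exact: multivectorD.
apply: PD => //; apply: (PM 0) => //; [exact: A_fn|exact: (A_frame phi0 sphi S).1|exact: Pf|].
suff [] : multivector (frame p phi S) /\ Phi (frame p phi S) by [].
apply: (big_rec (fun P : field M => multivector P /\ Phi P)) => [|i P _ [sP PP]].
  by split; [exact: multivector_fn (smooth_fun_cst 1)|exact: Pf (smooth_fun_cst 1)].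
have AE := A_frame_vec phi0 sphi i.
split; first by apply: multivector_wedge => //; exact: AE.1.
by apply: (PM 1) => //; exact: PV.
Qed.

(** This makes a single component of a form at [p] readable as a pairing with a global multivector
    field. *)
Lemma A_extend p (S : {set 'I_n}) : exists2 Z : field M, A #|S| Z & Z p = ext_basis S.
Proof.
have [phi [phi1 phi0 sphi]] := bump_extension (chart_at_atlas p) (chart_at_dom p).
by exists (frame p phi S); [exact: A_frame|exact: frame_center].
Qed.

End Frames.

(** * Parities of integer degrees *)

Lemma odd_abszD (k l : int) : odd (absz (k + l)) = odd (absz k) (+) odd (absz l).
Proof. lia. Qed.

Lemma odd_abszM (k l : int) : odd (absz (k * l)) = odd (absz k) && odd (absz l).
Proof. by rewrite abszM oddM. Qed.

(** * The Schouten bracket and the connection in coordinates *)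

Section Jets.
Context {R : realType} {n : nat} {M : manifold R n}.
Implicit Types (c : chart R n M) (p q : M) (f : M -> R) (P Q X Y Z w : field M) (k l m : int).
Hint Resolve chart_at_atlas chart_at_dom : core.

Definition mv_partial p (i : 'I_n) X : ext R n :=
  ext_partial i (mv_coord (chart_at p) X) (cmap (chart_at p) p).

Definition form_partial p (i : 'I_n) w : ext R n :=
  ext_partial i (form_coord (chart_at p) w) (cmap (chart_at p) p).

Lemma differentiable_mv_coord p X : multivector X ->
  ext_differentiable (mv_coord (chart_at p) X) (cmap (chart_at p) p).
Proof. by move=> sX S; apply: smooth_on_diff (sX _ _ S) (cimg_map _). Qed.

Lemma differentiable_form_coord p w : smooth_form w ->
  ext_differentiable (form_coord (chart_at p) w) (cmap (chart_at p) p).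
Proof. by move=> sw S; apply: smooth_on_diff (sw _ _ S) (cimg_map _). Qed.

Lemma mv_partial_wedge p i P Q : multivector P -> multivector Q ->
  mv_partial p i (wedge P Q) =
  ext_mul (mv_partial p i P) (Q p) + ext_mul (P p) (mv_partial p i Q).
Proof.
move=> sP sQ; rewrite /mv_partial.
have -> : mv_coord (chart_at p) (wedge P Q) =
    fun x => ext_mul (mv_coord (chart_at p) P x) (mv_coord (chart_at p) Q x).
  by apply/funext => x; exact: mv_coord_wedge.
rewrite (ext_partial_mul i _ _).2; try exact: differentiable_mv_coord.
by rewrite !mv_coord_center.
Qed.

Lemma mv_partialD p i P Q : multivector P -> multivector Q ->
  mv_partial p i (P + Q) = mv_partial p i P + mv_partial p i Q.
Proof.
move=> sP sQ; rewrite /mv_partial.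
have -> : mv_coord (chart_at p) (P + Q) =
    fun x => mv_coord (chart_at p) P x + mv_coord (chart_at p) Q x.
  by apply/funext => x; exact: mv_coordD.
by apply: ext_partialD; exact: differentiable_mv_coord.
Qed.

Lemma mv_partial_hom p i k P : homogeneous k P -> ext_hom k (mv_partial p i P).
Proof.
move=> hP S cS; rewrite /mv_partial ffunE.
rewrite (_ : (fun y => _) = cst 0) ?derive_cst //; apply/funext => x.
exact: (ext_map_hom _ (hP _) cS).
Qed.

Lemma form_partial_iprod p i Z w : multivector Z -> smooth_form w ->
  form_partial p i (iprod Z w) =
  ext_contract (mv_partial p i Z) (w p) + ext_contract (Z p) (form_partial p i w).
Proof.
move=> sZ sw; rewrite /form_partial.
(* The formula for the coordinates of a contraction is available on the image of the chart, a
   neighbourhood of the point, which suffices for derivatives. *)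
have e : \forall x \near cmap (chart_at p) p, form_coord (chart_at p) (iprod Z w) x =
    ext_contract (mv_coord (chart_at p) Z x) (form_coord (chart_at p) w x).
  have := open_nbhs_nbhs (conj (@cimg_open _ _ _ (chart_at p)) (cimg_map (chart_at_dom p))).
  by apply: filterS => x cx; exact: form_coord_iprod.
rewrite (eq_ext_partial i e) ext_partial_contract; first last.
- exact: differentiable_form_coord.
- exact: differentiable_mv_coord.
by rewrite mv_coord_center form_coord_center.
Qed.

(** The coordinate expression of the Schouten bracket at [p] for [X] of degree [k]: it involves only
    values and first derivatives at [p]. *)
Definition local_bracket p k X Y : ext R n :=
  \sum_(i < n) ((-1) ^ (k + 1) *: ext_mul (ext_iota i (X p)) (mv_partial p i Y)
                - ext_mul (mv_partial p i X) (ext_iota i (Y p))).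

Lemma lie_mv_local p X Q : A 1 X -> lie_mv X Q p = local_bracket p 1 X Q.
Proof.
move=> [_ hX]; rewrite /lie_mv -sumrB; apply: eq_bigr => i _; congr (_ - _).
(* For a vector the contraction by [dx_i] is the scalar [X_i]; all other components vanish for
   degree reasons. *)
have -> : ext_iota i (X p) = X p [set i]%SET *: ext_basis finset.set0.
  apply/ffunP => T; rewrite !ffunE; have [->|T0] := eqVneq T finset.set0.
    by rewrite ext_mul1r ext_pair_basis [_ *: _]mulr1.
  rewrite scaler0; apply: (ext_hom_pair (hX p) (ext_hom_mul (ext_hom_basis1 i) (ext_hom_basis T))).
  by have := T0; rewrite -cards_eq0; lia.
by rewrite ext_mulZl ext_mul1l signz_odd scale1r.
Qed.

Lemma local_bracketD p k X P Q : multivector P -> multivector Q ->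
  local_bracket p k X (P + Q) = local_bracket p k X P + local_bracket p k X Q.
Proof.
move=> sP sQ; rewrite -big_split; apply: eq_bigr => i _ /=.
rewrite mv_partialD // /ext_iota ext_contractDr !ext_mulDr scalerDr opprD.
by rewrite addrACA.
Qed.

(** Commuting the two factors of each product exchanges the two terms of every summand, up to a sign
    settled by parity. *)
Lemma local_bracket_anti p k l X Y : A k X -> A l Y ->
  local_bracket p k X Y = - ((-1) ^ ((k - 1) * (l - 1)) *: local_bracket p l Y X).
Proof.
move=> [_ hX] [_ hY]; rewrite scaler_sumr -sumrN; apply: eq_bigr => i _.
rewrite (ext_mulC (ext_iota_hom i (hX p)) (mv_partial_hom p i hY)).
rewrite (ext_mulC (mv_partial_hom p i hX) (ext_iota_hom i (hY p))).
move: (ext_mul _ _) (ext_mul _ _) => U V.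
rewrite !signz_odd !(odd_abszD, odd_abszM, abszN).
by apply/ffunP => S; rewrite !ffunE; case: (odd (absz k)); case: (odd (absz l));
  rewrite /GRing.scale /=; ring.
Qed.

(** Partial derivatives obey the product rule and [ext_iota i] is an antiderivation; the remaining
    signs come from moving [Q] past [ext_iota i (X p)] and the partial derivative of [X]. *)
Lemma local_bracket_wedge p k l X Q P : A k X -> A l Q -> multivector P ->
  local_bracket p k X (wedge Q P) =
  ext_mul (local_bracket p k X Q) (P p) +
  (-1) ^ ((k - 1) * l) *: ext_mul (Q p) (local_bracket p k X P).
Proof.
move=> [_ hX] [sQ hQ] sP.
rewrite /local_bracket ext_mul_suml ext_mul_sumr scaler_sumr -big_split.
apply: eq_bigr => i _ /=; rewrite mv_partial_wedge // (ext_iota_mul i _ (hQ p)).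
have e1 := ext_mulC (ext_iota_hom i (hX p)) (hQ p).
have e2 := ext_mulC (mv_partial_hom p i hX) (hQ p).
move: e1 e2 {hX hQ sQ sP}; rewrite /wedge.
set a := ext_iota i (X p); set da := mv_partial p i X; set q := Q p; set dq := mv_partial p i Q.
set s := P p; set ds := mv_partial p i P; move=> e1 e2.
rewrite !(ext_mulDr, ext_mulDl, ext_mulNl, ext_mulNr, ext_mulZl, ext_mulZr).
rewrite !ext_mulA e1 e2 !ext_mulZl.
move: (ext_mul _ _) (ext_mul _ _) (ext_mul (ext_mul q a) _) (ext_mul (ext_mul q da) _).
move=> U V W T.
rewrite !signz_odd !(odd_abszD, odd_abszM, abszN).
by apply/ffunP => S; rewrite !ffunE; case: (odd (absz k)); case: (odd (absz l));
  rewrite /GRing.scale /=; ring.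
Qed.

Lemma ext_iota_fn i f p : ext_iota i (fn f p) = 0.
Proof. by rewrite /ext_iota ext_contractZr -/(ext_iota i _) ext_iota_basis inE scaler0. Qed.

Lemma local_bracket_fn p f g : local_bracket p 0 (fn f) (fn g) = 0.
Proof.
by rewrite /local_bracket big1 // => i _; rewrite !ext_iota_fn ext_mul0l ext_mul0r scaler0 subr0.
Qed.

(** * Identification of the Schouten bracket with its coordinate expression *)

Section Bracket.
Variable br : field M -> field M -> field M.
Hypothesis br_schouten : is_schouten br.

Lemma schouten_local_ind p l Y : A l Y ->
  (forall f, smooth_fun f -> br Y (fn f) p = local_bracket p l Y (fn f)) ->
  (forall V, A 1 V -> br Y V p = local_bracket p l Y V) ->
  forall X, multivector X -> br Y X p = local_bracket p l Y X.
Proof.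
move=> AY Hf HV; have sY := AY.1; apply: (@multivector_ind _ _ _ p) => //.
- move=> P Q sP sQ hP hQ; rewrite local_bracketD // -hP -hQ.
  by have := schouten_linearr br_schouten 1 sY sP sQ; rewrite !scale1r => ->.
- move=> k P Q AP sQ hP hQ; rewrite (local_bracket_wedge _ AY AP sQ) -hP -hQ.
  by rewrite (schouten_leibniz br_schouten AY AP sQ).
(* In the Leibniz rules for [f X], the terms containing the bracket of [Y] with [f] agree and
   cancel; what is left is the claim for [X], because [f p = 1]. *)
- move=> f X sf fp sX; rewrite fscaleE.
  rewrite (local_bracket_wedge _ AY (A_fn sf) sX) (schouten_leibniz br_schouten AY (A_fn sf) sX).
  rewrite -Hf // mulr0 expr0z !scale1r => /addrI.
  by rewrite /wedge /fn fp !scale1r !ext_mul1l.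
Qed.

(** Two inductions on the second argument. With a vector field first, the formula is the Lie
    derivative; by antisymmetry this covers a function against a vector field, so the first
    induction settles functions in the first slot. Antisymmetry then supplies both base cases for an
    arbitrary [X]. *)
Lemma schouten_localE p k l X Y : A k X -> A l Y -> br X Y p = local_bracket p k X Y.
Proof.
have anti k' l' P Q : A k' P -> A l' Q -> br Q P p = local_bracket p l' Q P ->
    br P Q p = local_bracket p k' P Q.
  move=> AP AQ e; rewrite (schouten_anti br_schouten AP AQ) (local_bracket_anti p AP AQ).
  by rewrite -e.
have vec Q V l' : A 1 V -> A l' Q -> br V Q p = local_bracket p 1 V Q.
  by move=> AV AQ; rewrite (schouten_lie br_schouten AV AQ); exact: lie_mv_local.
have fun_l f Q : smooth_fun f -> multivector Q -> br (fn f) Q p = local_bracket p 0 (fn f) Q.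
  move=> sf; apply: schouten_local_ind => [|g sg|V AV]; first exact: A_fn.
    by rewrite (schouten_fun br_schouten) // local_bracket_fn.
  exact: (anti _ _ _ _ (A_fn sf) AV (vec _ _ _ AV (A_fn sf))).
move=> AX AY; apply: schouten_local_ind AY.1 => // [f sf|V AV].
  by apply: (anti _ _ _ _ AX (A_fn sf)); apply: fun_l => //; exact: AX.1.
exact: (anti _ _ _ _ AX AV (vec _ _ _ AV AX)).
Qed.

End Bracket.

Lemma fnE f p : fn f p finset.set0 = f p.
Proof. by rewrite !ffunE eqxx [_ *: _]mulr1. Qed.

Lemma ext_deriv0 : ext_deriv (0 : field M) = 0.
Proof.
apply/funext => p; rewrite /ext_deriv big1 // => i _.
have -> : form_coord (chart_at p) (0 : field M) = fun=> 0.
  apply/funext => x; apply: ext_pair_inj => S.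
  by rewrite ext_pair_form_coord !(ext_pairC 0) !ext_pair0r.
by rewrite ext_partial_cst ext_mul0r.
Qed.

Lemma iprod_deg_lt0 k m X w : homogeneous k X -> homogeneous m w -> m - k < 0 ->
  iprod X w = 0.
Proof.
move=> hX hw lt0; apply/funext => p.
exact: (ext_hom_lt0 (ext_hom_contract (hX p) (hw p)) lt0).
Qed.

Lemma lie_form0 k X : lie_form k X 0 = 0.
Proof.
have i0 : iprod X 0 = 0 by apply/funext => p; exact: ext_contract0r.
by rewrite /lie_form i0 ext_deriv0 i0 scaler0 subr0.
Qed.

(** The form [i_Z w] has degree [k - 1], so [i_X i_Z w] vanishes and only [i_X d i_Z w] contributes;
    the factor [dx_i] in [d] becomes [ext_iota i] on [X] by transposition. *)
Lemma lie_formE p k m X Z w : A k X -> A (m - k + 1) Z -> Omega m w ->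
  lie_form k X (iprod Z w) p finset.set0 = - (-1) ^ k *
    \sum_(i < n) (ext_pair (w p) (ext_mul (mv_partial p i Z) (ext_iota i (X p))) +
                  ext_pair (form_partial p i w) (ext_mul (Z p) (ext_iota i (X p)))).
Proof.
move=> [_ hX] [sZ hZ] [sw hw]; rewrite /lie_form.
have -> : iprod X (iprod Z w) = 0.
  apply: (@iprod_deg_lt0 k (m - (m - k + 1))) => //; last lia.
  by move=> q; exact: ext_hom_contract (hZ q) (hw q).
rewrite ext_deriv0 sub0r !ffunE ext_mul1r mulNr; congr (- (_ * _)).
rewrite ext_pair_suml; apply: eq_bigr => i _.
rewrite -/(form_partial p i (iprod Z w)) form_partial_iprod // ext_pair_iota.
by rewrite ext_pairDl !ext_pair_contract.
Qed.

(** * The covariant derivative of a form, uniformly in the degree *)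

Section NablaForm.
Variables (br nabla : field M -> field M -> field M).
Hypothesis nabla_hc : higher_connection br nabla.

Lemma nabla_r0 X : multivector X -> nabla X 0 = 0.
Proof.
move=> sX; have := hc_addr nabla_hc sX (@multivector0 _ _ M) (@multivector0 _ _ M).
by rewrite addr0 => /esym /eqP; rewrite -subr_eq0 addrK => /eqP.
Qed.

Lemma nabla_deg_le0 k X Z : A k X -> k <= 0 -> multivector Z -> nabla X Z = 0.
Proof.
move=> AX k0 sZ.
suff [f sf ->] : exists2 f, smooth_fun f & X = fn f by rewrite (hc_fun0 nabla_hc).
have [k_lt0|kge0] := ltP k 0.
  exists (fun=> 0); first exact: smooth_fun_cst.
  by rewrite (A_lt0 AX) //; apply/funext => p; rewrite /fn scale0r.
by apply: A0_fn; have <- : k = 0 by lia.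
Qed.

(* Outside the range 0 < k <= m + 1, where nabla_X w is 0 by convention, the
   right-hand side vanishes too, so no case distinction on degrees is needed. *)
Lemma nabla_formE k m X w eta : A k X -> Omega m w -> is_nabla_form nabla k m X w eta ->
  homogeneous (m - k + 1) eta /\
  forall Z, A (m - k + 1) Z -> forall p, pair eta Z p =
    (-1) ^ ((k - 1) * (m - 1)) * lie_form k X (iprod Z w) p finset.set0
    - pair w (nabla X Z) p.
Proof.
move=> AX [sw hw]; rewrite /is_nabla_form; case: ifPn => [_ [[_ heta] H]|ndeg ->].
  split=> // Z AZ p; have /(congr1 (fun P : field M => P p finset.set0)) := H Z AZ.
  by rewrite fnE => ->; rewrite !ffunE eqxx [X in _ - X]mulr1.
split=> [p|Z AZ p]; first exact: ext_hom0.
rewrite /pair ext_pairC ext_pair0r.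
suff [-> ->] : lie_form k X (iprod Z w) = 0 /\ nabla X Z = 0.
  by rewrite ext_pair0r ffunE mulr0 subr0.
(* For [k <= 0] the degree of [Z] exceeds [m], so [i_Z w] vanishes, as does [nabla X Z]. For
   [k > m + 1] the degree of [Z] is negative, so [Z] itself is zero. *)
have [k0|k0] := leP k 0.
  rewrite (nabla_deg_le0 AX k0 AZ.1) (iprod_deg_lt0 AZ.2 hw); last lia.
  by rewrite lie_form0.
have -> : Z = 0 by apply: (A_lt0 AZ); move: ndeg; rewrite k0 /=; lia.
rewrite nabla_r0; last exact: AX.1.
have -> : iprod 0 w = 0 by apply/funext => q; exact: ext_contract0l.
by rewrite lie_form0.
Qed.

End NablaForm.

(* The i-th term of the Cartan formula for i_Z w: the terms without a derivative
   of X or Y cancel since ext_iota i is an antiderivation, and the others make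
   up the bracket. *)
Lemma bracket_identity p i k l m X Y Z w :
  A k X -> A l Y -> A (m - (k + l) + 1) Z ->
  (-1) ^ ((k + l - 1) * (m - 1)) * - (-1) ^ (k + l) *
    (ext_pair (w p) (ext_mul (mv_partial p i Z) (ext_iota i (wedge X Y p))) +
     ext_pair (form_partial p i w) (ext_mul (Z p) (ext_iota i (wedge X Y p)))) =
  (-1) ^ l * ((-1) ^ ((k - 1) * (m - 1)) * - (-1) ^ k *
    (ext_pair (w p) (ext_mul (mv_partial p i (wedge Y Z)) (ext_iota i (X p))) +
     ext_pair (form_partial p i w) (ext_mul (wedge Y Z p) (ext_iota i (X p))))) +
  (-1) ^ (k * (l - 1)) * ((-1) ^ ((l - 1) * (m - 1)) * - (-1) ^ l *
    (ext_pair (w p) (ext_mul (mv_partial p i (wedge X Z)) (ext_iota i (Y p))) +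
     ext_pair (form_partial p i w) (ext_mul (wedge X Z p) (ext_iota i (Y p))))) -
  (-1) ^ l * ext_pair (w p) (ext_mul
     ((-1) ^ (k + 1) *: ext_mul (ext_iota i (X p)) (mv_partial p i Y)
                - ext_mul (mv_partial p i X) (ext_iota i (Y p))) (Z p)).
Proof.
move=> [sX hX] [sY hY] [sZ hZ].
rewrite !mv_partial_wedge // /wedge (ext_iota_mul i _ (hX p)).
have hdX := mv_partial_hom p i hX; have hdY := mv_partial_hom p i hY.
have hdZ := mv_partial_hom p i hZ.
have hiX := ext_iota_hom i (hX p); have hiY := ext_iota_hom i (hY p).
have {hX hY hZ} := (hX p, hY p, hZ p).
move: (X p) (Y p) (Z p) (mv_partial p i X) (mv_partial p i Y) (mv_partial p i Z) hdX hdY hdZ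
  hiX hiY => a b z da db dz hda hdb hdz.
move: (ext_iota i a) (ext_iota i b) => ia ib hia hib [[ha hb] hz].
move: (w p) (form_partial p i w) => u du.
rewrite !(ext_mulDr, ext_mulDl, ext_mulZr, ext_mulZl, ext_mulNl) -!ext_mulA.
(* These rules bring every triple product to one order: the factor from [X], then that from [Y],
   then that from [Z]. *)
have e1 (x y : ext R n) (r s : int) : ext_hom r x -> ext_hom s y ->
  ext_mul z (ext_mul x y) = (-1) ^ ((m - (k + l) + 1) * (r + s)) *: ext_mul x (ext_mul y z).
  by move=> hx hy; rewrite (ext_mulC hz (ext_hom_mul hx hy)) -ext_mulA.
have e1' (x y : ext R n) (r s : int) : ext_hom r x -> ext_hom s y ->
  ext_mul dz (ext_mul x y) = (-1) ^ ((m - (k + l) + 1) * (r + s)) *: ext_mul x (ext_mul y dz).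
  by move=> hx hy; rewrite (ext_mulC hdz (ext_hom_mul hx hy)) -ext_mulA.
have e2 (x y v : ext R n) (r s t : int) : ext_hom r x -> ext_hom s y -> ext_hom t v ->
  ext_mul y (ext_mul v x) = (-1) ^ ((s + t) * r) *: ext_mul x (ext_mul y v).
  by move=> hx hy hv; rewrite ext_mulA (ext_mulC (ext_hom_mul hy hv) hx).
rewrite (e1 _ _ _ _ hia hb) (e1 _ _ _ _ ha hib) (e1' _ _ _ _ hia hb) (e1' _ _ _ _ ha hib).
rewrite (e2 _ _ _ _ _ _ hia hdb hz) (e2 _ _ _ _ _ _ hia hb hdz) (e2 _ _ _ _ _ _ hia hb hz).
rewrite (ext_mulC hz hib) (ext_mulC hdz hib).
rewrite !(ext_mulZr, ext_pairDr, ext_pairZr, ext_pairNr).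
(* Both sides are now combinations of the same pairings, and the coefficients are compared for each
   choice of parities. *)
rewrite !signz_odd !(odd_abszD, odd_abszM, abszN).
by case: (odd (absz k)); case: (odd (absz l)); case: (odd (absz m)); rewrite /=; ring.
Qed.

End Jets.

(** * Comparison of the two sides by evaluation on multivector fields *)

Theorem theorem4p8 (R : realType) (n : nat) (M : manifold R n)
    (br : field M -> field M -> field M) (br_schouten : is_schouten br)
    (nabla : field M -> field M -> field M)
    (nabla_hc : higher_connection br nabla)
    (nabla_induced : induced nabla)
    (nabla_torsion_free : torsion_free br nabla)
    (k l m : int) (X Y w : field M)
    (hX : A k X) (hY : A l Y) (hw : Omega m w)
    (nXYw nXw nYw : field M)
    (hXYw : is_nabla_form nabla (k + l) m (wedge X Y) w nXYw)
    (hXw : is_nabla_form nabla k m X w nXw)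
    (hYw : is_nabla_form nabla l m Y w nYw) :
  nXYw = (-1) ^ l *: iprod Y nXw + (-1) ^ (k * (l - 1)) *: iprod X nYw.
Proof.
have [h0 H0] := nabla_formE nabla_hc (A_wedge hX hY) hw hXYw.
have [h1 H1] := nabla_formE nabla_hc hX hw hXw.
have [h2 H2] := nabla_formE nabla_hc hY hw hYw.
apply/funext => p; apply/ffunP => S.
(* Both sides are homogeneous of this degree, so only components at sets [S] of this cardinality
   need comparison. *)
have hr : ext_hom (m - (k + l) + 1)
    ((-1) ^ l *: iprod Y nXw p + (-1) ^ (k * (l - 1)) *: iprod X nYw p).
  apply: ext_homD; apply: ext_homZ.
    have -> : m - (k + l) + 1 = m - k + 1 - l by lia.
    exact: ext_hom_contract (hY.2 p) (h1 p).
  have -> : m - (k + l) + 1 = m - l + 1 - k by lia.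
  exact: ext_hom_contract (hX.2 p) (h2 p).
have [cS|/eqP cS] := eqVneq (#|S| : int) (m - (k + l) + 1); last first.
  by rewrite (h0 p) // (hr S).
have [Z AZ ZE] := A_extend p S; rewrite cS in AZ.
have AYZ : A (m - k + 1) (wedge Y Z).
  have -> : m - k + 1 = l + (m - (k + l) + 1) by lia.
  exact: A_wedge.
have AXZ : A (m - l + 1) (wedge X Z).
  have -> : m - l + 1 = k + (m - (k + l) + 1) by lia.
  exact: A_wedge.
transitivity (pair nXYw Z p); first by rewrite /pair ZE ext_pair_basis.
(* Contraction is the transpose of the wedge product, so evaluating [i_Y] of a form on [Z] is
   evaluating the form on [wedge Y Z]. *)
transitivity ((-1) ^ l * pair nXw (wedge Y Z) p + (-1) ^ (k * (l - 1)) * pair nYw (wedge X Z) p);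
  last by rewrite /pair /wedge -!ext_pair_contract ZE !ext_pair_basis !ffunE.
rewrite (H0 Z AZ p) (H1 _ AYZ p) (H2 _ AXZ p) {H0 H1 H2}.
rewrite (lie_formE p (A_wedge hX hY) AZ hw) (lie_formE p hX AYZ hw) (lie_formE p hY AXZ hw).
rewrite (induced_l nabla_induced hX hY AZ.1) (induced_r nabla_induced hX hY AZ.1).
rewrite (induced_r nabla_induced hY hX AZ.1).
have /(congr1 (fun P : field M => P p)) := nabla_torsion_free _ _ _ _ hX hY.
rewrite /torsion => tor.
(* Vanishing torsion trades [nabla X Y] for [nabla Y X] plus the bracket, the latter in
   coordinates. *)
have {}tor : nabla X Y p = (-1) ^ ((k - 1) * (l - 1)) *: nabla Y X p + local_bracket p k X Y.
  rewrite -(schouten_localE br_schouten p hX hY); apply/eqP.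
  by rewrite -subr_eq0 opprD addrA; apply/eqP.
(* Summing [bracket_identity] over [i] expresses the Lie derivative term on the left by the two on
   the right and a bracket term. *)
have key := eq_bigr _ (fun i (_ : true) => bracket_identity p i w hX hY AZ).
have {key} := key 0 +%R (index_enum 'I_n).
rewrite sumrB big_split /= -!mulr_sumr -ext_pair_sumr -ext_mul_suml -/(local_bracket p k X Y).
rewrite !mulrA => ->.
have pairD (P Q : field M) : pair w (P + Q) p = pair w P p + pair w Q p := ext_pairDr _ _ _.
have pairZ (a : R) (P : field M) : pair w (a *: P) p = a * pair w P p := ext_pairZr _ _ _.
rewrite !pairD !pairZ [pair w (wedge (nabla X Y) Z) p]/pair /wedge tor ext_mulDl ext_mulZl.
rewrite ext_pairDr ext_pairZr /pair.
(* The pairings of [w] with the terms in [nabla X Z], [nabla Y Z], [nabla Y X] and the bracket now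
   match or cancel, parity by parity. *)
rewrite !signz_odd !(odd_abszD, odd_abszM, abszN).
by case: (odd (absz k)); case: (odd (absz l)); case: (odd (absz m)); rewrite /=; ring.
Qed.
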